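(* Let $R$ be a one-dimensional local Noetherian ring with finite residue field $k$. The smallest positive integer $n$ such that every ideal of $R$ has an $n$-generated reduction is $$ n = \left\lceil \: -1 + \log_{|k|}\left(\: |k| + (|k|-1)\cdot |\operatorname{Max}(\overline{R_{red}})|\: \right) \: \right\rceil.$$
   Context: All rings are commutative. For an ideal $I$ of a Noetherian ring $R$, a reduction of $I$ is an ideal $J\subseteq I$ such that $I^{m+1}=JI^m$ for some $m>0$; it is $n$-generated if it can be generated by $n$ elements. $R_{red}=R/\sqrt{0}$ is the quotient of $R$ by its nilradical, $\overline{A}$ denotes the integral closure of a ring $A$ in its total quotient ring, and $\operatorname{Max}(A)$ is the set of maximal ideals of $A$. *)

(* Defs.v *)
From HB Require Import structures.
From mathcomp Require Import all_boot all_order all_algebra.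
From Stdlib Require Rdefinitions Rpower.
From mathcomp Require Import Rstruct.
Set Implicit Arguments. Unset Strict Implicit. Unset Printing Implicit Defensive.
Import Order.TTheory GRing.Theory Num.Theory.
Local Open Scope ring_scope.

Section CommAlg.
Variable A : comNzRingType.

Definition same_set (I J : A -> Prop) := forall x, I x <-> J x.
Definition subset (I J : A -> Prop) := forall x, I x -> J x.

Definition is_ideal (I : A -> Prop) :=
  [/\ I 0, (forall x y, I x -> I y -> I (x + y)) & (forall r x, I x -> I (r * x))].

Definition ideal_gen (s : seq A) : A -> Prop :=
  fun x => exists c : seq A, size c = size s /\
     x = \sum_(i < size s) c`_i * s`_i.

Definition ideal_mul (I J : A -> Prop) : A -> Prop :=
  fun x => exists (a b : seq A), [/\ size a = size b,
     (forall i, (i < size a)%N -> I a`_i /\ J b`_i) &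
     x = \sum_(i < size a) a`_i * b`_i].

Definition ideal_pow (I : A -> Prop) (n : nat) : A -> Prop :=
  iter n (ideal_mul I) (fun _ => True).

Definition is_reduction (J I : A -> Prop) :=
  [/\ is_ideal J, subset J I &
      exists m : nat, (0 < m)%N /\ same_set (ideal_pow I m.+1) (ideal_mul J (ideal_pow I m))].

Definition has_n_gen_reduction (I : A -> Prop) (n : nat) :=
  exists s : seq A, size s = n /\ is_reduction (ideal_gen s) I.

Definition proper_ideal (I : A -> Prop) := is_ideal I /\ ~ I 1.
Definition maximal_ideal (M : A -> Prop) :=
  proper_ideal M /\ forall J, proper_ideal J -> subset M J -> subset J M.
Definition prime_ideal (P : A -> Prop) :=
  proper_ideal P /\ forall a b, P (a * b) -> P a \/ P b.
Definition strict_subset (I J : A -> Prop) := subset I J /\ ~ subset J I.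

Definition noetherian := forall I, is_ideal I -> exists s, same_set I (ideal_gen s).

Definition local_with_max (m : A -> Prop) :=
  maximal_ideal m /\ forall M, maximal_ideal M -> same_set M m.

Definition krull_dim_one :=
  (exists P Q, [/\ prime_ideal P, prime_ideal Q & strict_subset P Q]) /\
  ~ (exists P Q S, [/\ prime_ideal P, prime_ideal Q, prime_ideal S,
                       strict_subset P Q & strict_subset Q S]).

(* the residue field A/m is finite with exactly q elements:
   q pairwise incongruent representatives covering all classes mod m *)
Definition residue_card (m : A -> Prop) (q : nat) :=
  exists s : seq A, [/\ size s = q,
    (forall i j, (i < q)%N -> (j < q)%N -> m (s`_i - s`_j) -> i = j) &
    (forall x, exists2 i, (i < q)%N & m (x - s`_i))].

(* nilpotent elements = nilradical; x = 0 in A_red iff nilp x *)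
Definition nilp (x : A) := exists n : nat, x ^+ n = 0.
Definition nzd_red (s : A) := forall x, nilp (s * x) -> nilp x.

(* elements of Q(A_red): fractions (a,s) = a/s with s a nzd of A_red *)
Definition frac := (A * A)%type.
Definition frac_valid (f : frac) := nzd_red f.2.
Definition frac_eq (f g : frac) := nilp (f.1 * g.2 - g.1 * f.2).
Definition frac_add (f g : frac) : frac := (f.1 * g.2 + g.1 * f.2, f.2 * g.2).
Definition frac_mul (f g : frac) : frac := (f.1 * g.1, f.2 * g.2).
Definition frac0 : frac := (0, 1).
Definition frac1 : frac := (1, 1).

(* a/s is integral over A_red: root of a monic polynomial
   X^d + c_(d-1) X^(d-1) + ... + c_0 (coefficients lifted to A);
   clearing denominators: a^d + sum_i c_i a^i s^(d-i) = 0 in A_red *)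
Definition frac_integral (f : frac) :=
  exists c : seq A,
    nilp (f.1 ^+ size c + \sum_(i < size c) c`_i * f.1 ^+ i * f.2 ^+ (size c - i)).

Definition in_cl (f : frac) := frac_valid f /\ frac_integral f.

Definition cl_ideal (K : frac -> Prop) :=
  [/\ forall f, K f -> in_cl f,
      forall f g, K f -> in_cl g -> frac_eq f g -> K g,
      K frac0,
      forall f g, K f -> K g -> K (frac_add f g) &
      forall r f, in_cl r -> K f -> K (frac_mul r f)].

Definition cl_proper (K : frac -> Prop) :=
  cl_ideal K /\ forall f, K f -> ~ frac_eq f frac1.
Definition cl_maximal (K : frac -> Prop) :=
  cl_proper K /\ forall K', cl_proper K' -> (forall f, K f -> K' f) -> forall f, K' f -> K f.

Definition card_max_cl (N : nat) :=
  exists Ms : nat -> frac -> Prop,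
    [/\ forall i, (i < N)%N -> cl_maximal (Ms i),
        forall i j, (i < N)%N -> (j < N)%N -> (forall f, Ms i f <-> Ms j f) -> i = j &
        forall K, cl_maximal K -> exists2 i, (i < N)%N & forall f, K f <-> Ms i f].

End CommAlg.

Definition logb (b x : Rdefinitions.R) : Rdefinitions.R := Rpower.ln x / Rpower.ln b.

(* Main.v *)
(** Let [Q] be the total quotient ring of [A_red], [B] the integral closure of [A_red] in [Q] and [k]
the residue field, with [q] elements; write [G n = 1 + q + ... + q^(n-1)].

If [x] in [m] is regular in [A_red] and [I] is an ideal of finite colength, then [I/xI] has at most
[|A_red/xA_red|] elements. This bound has two consequences. Applied to multiples of elements of [B]
that separate maximal ideals, it shows that [Max B] is finite. Applied to the powers of [(g, h)], it
gives a relation between the monomials in [g] and [h] with a unit coefficient, and such a relation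
makes [g] and [h] comparable for divisibility at every maximal ideal [K] of [B].

Hence at each [K] where an ideal [I] does not vanish, a generator [d] of [I] divides all of [I], and
the elements of [I] that lie in [dK] locally form a proper submodule [H_K] containing [mI]. An ideal
[J] inside [I] that is contained in no [H_K] satisfies [JB = IB], so it is a reduction of [I] by the
determinant trick. A counting argument over [k] produces [n] elements of [I] that avoid fewer than
[G (n+1)] such submodules. Conversely, if [B] has at least [G (n+1)] maximal ideals, the Chinese
remainder theorem gives [n+1] elements of [B] whose residues at these maximal ideals run through all
points of projective [n]-space over [k]; the ideal that they generate, with denominators cleared, has
no [n]-generated reduction. *)
Require Import Defs.
From HB Require Import structures.
From mathcomp Require Import all_boot all_order all_algebra.
From Stdlib Require Rdefinitions Rpower.
From mathcomp Require Import Rstruct.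
From mathcomp Require classical_sets.
From mathcomp Require Import boolp ring zify.
(* Imported again so that [subset] and [frac] are not those of MathComp. *)
Require Import Defs.
Set Implicit Arguments. Unset Strict Implicit. Unset Printing Implicit Defensive.
Import Order.TTheory GRing.Theory Num.Theory.
Local Open Scope ring_scope.

(** * Ideals of Noetherian rings *)

Section Ideals.
Variable A : comNzRingType.
Implicit Types (I J P : A -> Prop) (x y : A).

Lemma idealN I x : is_ideal I -> I x -> I (- x).
Proof. by case=> _ _ H /(H (-1)); rewrite mulN1r. Qed.

Lemma idealB I x y : is_ideal I -> I x -> I y -> I (x - y).
Proof. by move=> HI Hx /(idealN HI); case: HI => _ H _; exact: H. Qed.

Lemma idealMr I x y : is_ideal I -> I x -> I (x * y).
Proof. by case=> _ _ H; rewrite mulrC; exact: H. Qed.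

Lemma ideal_sum I (T : Type) (r : seq T) (Pr : pred T) (F : T -> A) :
  is_ideal I -> (forall i, Pr i -> I (F i)) -> I (\sum_(i <- r | Pr i) F i).
Proof. by case=> H0 HD _ HF; apply: big_ind. Qed.

Lemma ideal_1 I x : is_ideal I -> I 1 -> I x.
Proof. by move=> HI H1; rewrite -[x]mul1r; apply: idealMr. Qed.

Lemma ideal_genP (s : seq A) x :
  ideal_gen s x <-> exists c : nat -> A, x = \sum_(i < size s) c i * s`_i.
Proof.
split=> [[c [_ ->]]|[c ->]]; first by exists (nth 0 c).
exists (mkseq c (size s)); rewrite size_mkseq; split=> //.
by apply: eq_bigr => i _; rewrite nth_mkseq.
Qed.

Lemma is_ideal_gen (s : seq A) : is_ideal (ideal_gen s).
Proof.
split.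
- by apply/ideal_genP; exists (fun=> 0); rewrite big1 // => i _; rewrite mul0r.
- move=> x y /ideal_genP[c ->] /ideal_genP[d ->]; apply/ideal_genP.
  exists (fun i => c i + d i); rewrite -big_split.
  by apply: eq_bigr => i _; rewrite mulrDl.
- move=> r x /ideal_genP[c ->]; apply/ideal_genP; exists (fun i => r * c i).
  by rewrite mulr_sumr; apply: eq_bigr => i _; rewrite mulrA.
Qed.

Lemma ideal_gen_mem (s : seq A) x : x \in s -> ideal_gen s x.
Proof.
move=> xs; apply/ideal_genP; exists (fun i => (i == index x s)%:R).
have lt : (index x s < size s)%N by rewrite index_mem.
rewrite (bigD1 (Ordinal lt)) //= eqxx mul1r nth_index // big1 ?addr0 // => i.
by rewrite -val_eqE /= => /negPf ->; rewrite mul0r.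
Qed.

Lemma ideal_gen_min (s : seq A) I :
  is_ideal I -> (forall x, x \in s -> I x) -> subset (ideal_gen s) I.
Proof.
move=> HI Hs x /ideal_genP[c ->]; apply: ideal_sum => // i _.
by case: (HI) => _ _; apply; apply/Hs/mem_nth.
Qed.

Lemma ideal_mul_mem I J x y : I x -> J y -> ideal_mul I J (x * y).
Proof.
move=> Ix Jy; exists [:: x], [:: y]; split=> //; first by case.
by rewrite big_ord1.
Qed.

Lemma is_ideal_mul I J : is_ideal I -> is_ideal (ideal_mul I J).
Proof.
move=> HI; split.
- by exists [::], [::]; split=> //; rewrite big_ord0.
- move=> _ _ [a [b [sab H ->]]] [a' [b' [sab' H' ->]]].
  exists (a ++ a'), (b ++ b'); split; first by rewrite !size_cat sab sab'.
    move=> i; rewrite size_cat !nth_cat -sab => Hi.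
    by case: ltnP => Hia; [exact: H | apply: H'; rewrite ltn_subLR].
  rewrite size_cat big_split_ord /=; congr (_ + _); apply: eq_bigr => i _.
    by rewrite !nth_cat -sab ltn_ord.
  by rewrite !nth_cat -sab ltnNge leq_addr /= addKn.
- move=> r _ [a [b [sab H ->]]]; exists (map ( *%R r) a), b.
  rewrite size_map; split=> // [i Hi|].
    by case: (H i Hi) => Ha Hb; rewrite (nth_map 0) //; split=> //; case: HI => _ _; apply.
  by rewrite mulr_sumr; apply: eq_bigr => i _; rewrite (nth_map 0) // mulrA.
Qed.

Lemma ideal_mul_min I J (L : A -> Prop) : L 0 -> (forall x y, L x -> L y -> L (x + y)) ->
  (forall x y, I x -> J y -> L (x * y)) -> subset (ideal_mul I J) L.
Proof.
move=> L0 LD LM _ [a [b [_ H ->]]]; apply: (big_ind L) => // i _.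
by case: (H i (ltn_ord i)) => *; apply: LM.
Qed.

Lemma ideal_mulS I I' J J' : is_ideal I' -> subset I I' -> subset J J' ->
  subset (ideal_mul I J) (ideal_mul I' J').
Proof.
move=> HI' sI sJ; have [H0 HD _] := is_ideal_mul J' HI'.
by apply: ideal_mul_min => // x y /sI ? /sJ ?; apply: ideal_mul_mem.
Qed.

Lemma is_ideal_pow I n : is_ideal I -> is_ideal (ideal_pow I n).
Proof. by move=> HI; case: n => [|n]; [by split | exact: is_ideal_mul]. Qed.

Definition colon I a x := I (a * x).
Definition add_principal I a x := exists r y, I y /\ x = y + r * a.

Lemma is_ideal_colon I a : is_ideal I -> is_ideal (colon I a).
Proof.
case=> H0 HD HM; split=> [|x y Hx Hy|r x Hx]; rewrite /colon ?mulr0 //.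
  by rewrite mulrDr; apply: HD.
by rewrite mulrCA; apply: HM.
Qed.

Lemma is_ideal_add_principal I a : is_ideal I -> is_ideal (add_principal I a).
Proof.
case=> H0 HD HM; split.
- by exists 0, 0; rewrite mul0r addr0.
- move=> _ _ [r [y [Iy ->]]] [r' [y' [Iy' ->]]]; exists (r + r'), (y + y').
  by split; [exact: HD | ring].
- move=> t _ [r [y [Iy ->]]]; exists (t * r), (t * y).
  by split; [exact: HM | ring].
Qed.

Lemma add_principalS I a : subset I (add_principal I a).
Proof. by move=> x Ix; exists 0, x; rewrite mul0r addr0. Qed.

Lemma add_principal_mem I a : is_ideal I -> add_principal I a a.
Proof. by case=> I0 _ _; exists 1, 0; rewrite add0r mul1r. Qed.

Lemma nilp0 : nilp (0 : A). Proof. by exists 1%N; rewrite expr1. Qed.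

Lemma nilpD x y : nilp x -> nilp y -> nilp (x + y).
Proof.
move=> [a xa0] [b yb0]; exists (a + b)%N; rewrite exprDn big1 // => i _.
case: (leqP b i) => bi.
  by rewrite -(subnKC bi) exprD yb0 mul0r mulr0 mul0rn.
have ai : (a <= a + b - i)%N by rewrite -addnBA ?leq_addr // ltnW.
by rewrite -(subnKC ai) exprD xa0 mul0r mul0r mul0rn.
Qed.

Lemma nilpMr x y : nilp x -> nilp (x * y).
Proof. by move=> [n xn0]; exists n; rewrite exprMn xn0 mul0r. Qed.

Lemma is_ideal_nilp : is_ideal (@nilp A).
Proof.
split; [exact: nilp0 | exact: nilpD |].
by move=> r x Hx; rewrite mulrC; apply: nilpMr.
Qed.

Lemma nilp_exp x n : nilp (x ^+ n) -> nilp x.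
Proof. by move=> [k]; rewrite -exprM; exists (n * k)%N. Qed.

Lemma nzd_redM x y : nzd_red x -> nzd_red y -> nzd_red (x * y).
Proof. by move=> Hx Hy z; rewrite -mulrA => /Hx /Hy. Qed.

Lemma nzd_redX x n : nzd_red x -> nzd_red (x ^+ n).
Proof.
move=> Hx; elim: n => [|n IH]; first by move=> y; rewrite mul1r.
by rewrite exprS; apply: nzd_redM.
Qed.

Lemma prime_exp P x n : prime_ideal P -> P (x ^+ n) -> P x.
Proof.
move=> [[HI H1] HP]; elim: n => [|n IH]; first by move/H1.
by rewrite exprS => /HP[//|/IH].
Qed.

Lemma prime_nilp P x : prime_ideal P -> nilp x -> P x.
Proof.
by move=> HP [n xn0]; apply: (prime_exp (n := n)) => //; rewrite xn0; case: HP => [[[]]].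
Qed.

(** * Maximal members of families of ideals, regular elements modulo nilpotents, finite quotients *)

Section Noetherian.
Hypothesis noethA : noetherian A.

(** Failure would give, by dependent choice, a strictly increasing chain above [I0]. The generators
    of its union already lie in one stage, so the next inclusion could not be strict. *)
Lemma noetherian_max (C : (A -> Prop) -> Prop) I0 :
  (forall I, C I -> is_ideal I) -> C I0 ->
  exists I, [/\ C I, subset I0 I & forall J, C J -> subset I J -> subset J I].
Proof.
move=> HC CI0; apply: contrapT => Hno.
pose T := {I | C I /\ subset I0 I}.
have step (t : T) : {u : T | strict_subset (sval t) (sval u)}.
  apply: cid; case: t => I [CI sI] /=; apply: contrapT => Hn; apply: Hno.
  exists I; split=> // J CJ sIJ; apply: contrapT => nJI; apply: Hn.
  have sJ : subset I0 J by move=> x /sI /sIJ.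
  by exists (exist _ J (conj CJ sJ)).
pose t0 : T := exist _ I0 (conj CI0 (fun x h => h)).
pose F n := sval (iter n (fun t => sval (step t)) t0).
have FS n : strict_subset (F n) (F n.+1) by rewrite /F iterS; case: (step _).
have Fle i j : (i <= j)%N -> subset (F i) (F j).
  move/subnK <-; elim: (j - i)%N => [|k IH] // x /IH.
  by case: (FS (k + i)%N) => + _; apply.
have FI n : is_ideal (F n) by rewrite /F; case: (iter _ _ _) => I /= [/HC].
pose U x := exists n, F n x.
have HU : is_ideal U.
  split; first by exists 0%N; case: (FI 0%N).
    move=> x y [i Fx] [j Fy]; exists (maxn i j); case: (FI (maxn i j)) => _ HD _.
    by apply: HD; [apply: (Fle i) Fx; exact: leq_maxl | apply: (Fle j) Fy; exact: leq_maxr].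
  by move=> r x [i Fx]; exists i; case: (FI i) => _ _; apply.
have [s Hs] := noethA HU.
have [n Hn] : exists n, forall x, x \in s -> F n x.
  have : forall x, x \in s -> U x by move=> x xs; apply/Hs/ideal_gen_mem.
  elim: s {Hs} => [|a s IH] Hs; first by exists 0%N.
  have [n Hn] : exists n, forall x, x \in s -> F n x.
    by apply: IH => x xs; apply: Hs; rewrite inE xs orbT.
  have [k Hk] := Hs a (mem_head _ _).
  exists (maxn n k) => x; rewrite inE => /orP[/eqP ->|/Hn].
    by apply: Fle Hk; exact: leq_maxr.
  by apply: Fle; exact: leq_maxl.
case: (FS n) => _; apply=> x Fx.
by apply: (ideal_gen_min (FI n) Hn); apply/Hs; exists n.+1.
Qed.

Lemma exists_maximal I : proper_ideal I -> exists2 M, maximal_ideal M & subset I M.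
Proof.
move=> HI; have [|M [HM sM maxM]] := @noetherian_max (fun J => proper_ideal J) I _ HI.
  by move=> J [].
by exists M.
Qed.

(** An ideal maximal among those disjoint from [S] is prime: if it omits [a] and [b], enlarging it
    by either one meets [S], and the product of the two meeting elements lies in the ideal as soon
    as [a * b] does. *)
Lemma exists_prime_avoiding (S : A -> Prop) : S 1 ->
  (forall x y, S x -> S y -> S (x * y)) -> ~ S 0 ->
  exists2 P, prime_ideal P & forall x, P x -> ~ S x.
Proof.
move=> S1 SM S0.
pose C I := is_ideal I /\ forall x, I x -> ~ S x.
have C0 : C (fun x => x = 0).
  split; last by move=> x ->.
  by split=> [|x y -> ->|r x ->]; rewrite ?addr0 ?mulr0.
have [|P [[HP dP] _ maxP]] := @noetherian_max C _ _ C0; first by move=> I [].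
exists P => //; split; first by split=> // /dP.
move=> a b Pab; apply: contrapT => /not_orP[nPa nPb].
have meet c : ~ P c -> exists2 x, add_principal P c x & S x.
  move=> nPc; apply: contrapT => Hn.
  have /maxP : C (add_principal P c).
    split; first exact: is_ideal_add_principal.
    by move=> x Hx Sx; apply: Hn; exists x.
  move=> /(_ (@add_principalS _ _)) /(_ c (add_principal_mem _ HP)).
  exact: nPc.
have [_ [r [x [Px ->]]] Sx] := meet a nPa.
have [_ [t [y [Py ->]]] Sy] := meet b nPb.
apply: (dP ((x + r * a) * (y + t * b))); last exact: SM.
have -> : (x + r * a) * (y + t * b) = x * (y + t * b) + (r * a * y + r * t * (a * b)).
  by ring.
case: (HP) => _ HD HM; apply: (HD); first exact: idealMr.
by apply: HD; exact: HM.
Qed.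

(* The element [z] is chosen with maximal annihilator-of-annihilator. *)
Lemma nzd_red_complement (g : A) : exists z, nilp (g * z) /\ nzd_red (g + z).
Proof.
(* [D z] is the annihilator of the annihilator of [z] in [A_red]. *)
pose D z y := forall w, nilp (w * z) -> nilp (w * y).
have HD z : is_ideal (D z).
  split=> [w _|x y Hx Hy w Hw|r x Hx w Hw].
  - by rewrite mulr0; exact: nilp0.
  - by rewrite mulrDr; apply: nilpD; [exact: Hx|exact: Hy].
  - by rewrite mulrCA mulrC; apply/nilpMr/Hx.
pose C I := exists2 z, nilp (g * z) & I = D z.
have [||_ [[z gz ->] _ maxz]] := @noetherian_max C (D 0).
- by move=> _ [z _ ->].
- by exists 0 => //; rewrite mulr0; exact: nilp0.
have sq w y : nilp (w * y * y) -> nilp (w * y).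
  move=> H; apply: (nilp_exp (n := 2)).
  have -> : (w * y) ^+ 2 = w * y * y * w by ring.
  exact: nilpMr.
exists z; split=> // w; rewrite mulrC => Hw.
have HN := is_ideal_nilp.
have wg : nilp (w * g).
  apply: sq; have -> : w * g * g = w * (g + z) * g - w * (g * z) by ring.
  by apply: idealB => //; [exact: nilpMr | rewrite mulrC; exact: nilpMr].
have wz : nilp (w * z).
  have -> : w * z = w * (g + z) - w * g by ring.
  exact: idealB.
(* [z + w] still annihilates [g], and its double annihilator contains that of [z] and also [w]. By
   maximality [w] lies in [D z]; as [w] kills [z], it kills itself. *)
have Cz' : C (D (z + w)).
  by exists (z + w) => //; rewrite mulrDr; apply: nilpD => //; rewrite mulrC.
have sub : subset (D z) (D (z + w)).
  move=> y Hy v Hv; apply: Hy; apply: sq.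
  have -> : v * z * z = v * (z + w) * z - v * (w * z) by ring.
  by apply: idealB => //; [exact: nilpMr | rewrite mulrC; exact: nilpMr].
have wD : D (z + w) w.
  move=> v Hv; apply: sq.
  have -> : v * w * w = v * (z + w) * w - v * (w * z) by ring.
  by apply: idealB => //; [exact: nilpMr | rewrite mulrC; exact: nilpMr].
have := maxz _ Cz' sub w wD w wz; rewrite -expr2; exact: nilp_exp.
Qed.

Definition finite_quotient I := exists s : seq A, forall a, exists2 r, r \in s & I (a - r).

Lemma finite_quotientS I J : subset I J -> finite_quotient I -> finite_quotient J.
Proof. by move=> IJ [s Hs]; exists s => a; have [r rs /IJ] := Hs a; exists r. Qed.

(** [A / I] is an extension of [A / (I + aA)] by [(I + aA) / I], which is isomorphic to
    [A / (I : a)]; hence the representatives [r + a * u]. *)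
Lemma finite_quotient_colon I a : is_ideal I ->
  finite_quotient (add_principal I a) -> finite_quotient (colon I a) -> finite_quotient I.
Proof.
move=> HI [s Hs] [t Ht]; exists [seq r + a * u | r <- s, u <- t] => x.
have [r rs [c [y [Iy Ey]]]] := Hs x; have [u ut Iu] := Ht c.
exists (r + a * u); first exact: allpairs_f.
have -> : x - (r + a * u) = y + a * (c - u).
  by rewrite opprD addrA Ey; ring.
by case: (HI) => _ + _; apply.
Qed.

(* An ideal maximal among those containing [I] with infinite quotient is prime. *)
Lemma finite_quotient_of_primes I : is_ideal I ->
  (forall P, prime_ideal P -> subset I P -> finite_quotient P) -> finite_quotient I.
Proof.
move=> HI HP; apply: contrapT => nI.
pose C J := is_ideal J /\ ~ finite_quotient J.
have [|P [[idP infP] sP maxP]] := @noetherian_max C I _ (conj HI nI); first by move=> J [].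
apply: (infP); apply: HP => //; split.
  split=> // P1; apply: infP; exists [:: 0] => a; exists 0; first exact: mem_head.
  exact: ideal_1.
move=> a b Pab; apply: contrapT => /not_orP[nPa nPb].
have big J c : is_ideal J -> subset P J -> J c -> ~ P c -> finite_quotient J.
  move=> HJ PJ Jc nPc; apply: contrapT => nJ; apply: nPc.
  by apply: (maxP J).
apply: infP; apply: (finite_quotient_colon (a := a)) => //.
  apply: (big _ a) => //; first exact: is_ideal_add_principal.
    exact: add_principalS.
  exact: add_principal_mem.
apply: (big _ b) => //; first exact: is_ideal_colon.
by move=> x Px; rewrite /colon; case: idP => _ _; apply.
Qed.

End Noetherian.

(* The classes of [A] modulo [xI + nil] are counted along [A > I > xI] and along [A > xA > xI]. *)
Lemma incongruent_family_bound I x (L : nat) (T : finType) (y : T -> A) (s : seq A) :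
  is_ideal I -> subset (@nilp A) I -> finite_quotient I ->
  size s = L -> (forall a, exists2 r, r \in s & exists b, nilp (a - r - x * b)) ->
  (L < #|T|)%N -> (forall t, I (y t)) ->
  exists t u : T, t <> u /\ exists2 w, I w & nilp (y t - y u - x * w).
Proof.
move=> HI nI [r0 Hr0] sL Hs LT Iy.
(* The finite cover is thinned to a complete irredundant system [r] of representatives of [A / I];
   its size [p] cancels in the count below. *)
have [r [r_neq0 rI rcov]] : exists r : seq A, [/\ (0 < size r)%N,
    (forall i j, (i < size r)%N -> (j < size r)%N -> I (r`_i - r`_j) -> i = j) &
    forall a, exists2 i, (i < size r)%N & I (a - r`_i)].
  have : exists r : seq A, 
    (forall i j, (i < size r)%N -> (j < size r)%N -> I (r`_i - r`_j) -> i = j) /\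
    forall a, a \in r0 -> exists2 i, (i < size r)%N & I (a - r`_i).
    elim: r0 {Hr0} => [|a r0 [r [rI rcov]]]; first by exists [::].
    have [[i ir Ii]|na] := pselect (exists2 i, (i < size r)%N & I (a - r`_i)).
      by exists r; split=> // b; rewrite inE => /orP[/eqP ->|/rcov //]; exists i.
    exists (a :: r); split.
      move=> [|i] [|j] //= ir jr Iij.
      - by case: na; exists j.
      - by case: na; exists i => //; rewrite -opprB; apply: idealN.
      - by congr S; apply: rI.
    move=> b; rewrite inE => /orP[/eqP ->|/rcov[i ir Ii]].
      by exists 0%N => //=; rewrite subrr; case: HI.
    by exists i.+1.
  move=> [r [rI rcov]]; exists r; split=> //; last first.
    move=> a; have [b /rcov[i ir Ii] Ib] := Hr0 a; exists i => //.
    by rewrite -[a](subrK b) -addrA; case: (HI) => _ + _; apply.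
  have [b /rcov[i ir _] _] := Hr0 0; exact: leq_ltn_trans ir.
pose p := size r.
have cov a : exists ki : 'I_L * 'I_p, exists2 w, I w & nilp (a - s`_ki.1 - x * r`_ki.2 - x * w).
  have [c cs [b Hb]] := Hs a; have [i ir Ii] := rcov b.
  have ks : (index c s < L)%N by rewrite -sL index_mem.
  exists (Ordinal ks, Ordinal ir); exists (b - r`_i) => //=; rewrite nth_index //.
  by have -> : a - c - x * r`_i - x * (b - r`_i) = a - c - x * b by ring.
pose f (ti : T * 'I_p) := sval (cid (cov (y ti.1 + r`_ti.2))).
have Hf (ti : T * 'I_p) : exists2 w, I w &
    nilp (y ti.1 + r`_ti.2 - s`_(f ti).1 - x * r`_(f ti).2 - x * w).
  by rewrite /f; case: cid.
have HN := is_ideal_nilp.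
have : ~ injective f.
  move=> /leq_card; rewrite !card_prod !card_ord leq_pmul2r // leqNgt.
  by rewrite LT.
move=> /existsNP[[t i]] /existsNP[[u j]] /not_implyP[Efg Ne].
have [w Iw Hw] := Hf (t, i); have [v Iv Hv] := Hf (u, j).
move: Hw Hv; rewrite Efg /=; set c := (x * r`__); move=> Hw Hv.
have {Hw Hv} H := idealB HN Hw Hv.
have {}H : nilp (y t - y u - x * (w - v) + (r`_i - r`_j)).
  by congr (nilp _): H; ring.
have Iwv : I (w - v) by apply: idealB.
have [eij|neq] := eqVneq i j.
  exists t, u; split; first by move=> etu; apply: Ne; rewrite etu eij.
  by exists (w - v) => //; move: H; rewrite eij subrr addr0.
case/eqP: neq; apply/val_inj/rI => //=.
have -> : r`_i - r`_j = y t - y u - x * (w - v) + (r`_i - r`_j) - (y t - y u - x * (w - v)).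
  by ring.
have HM : I (x * (w - v)) by case: (HI) => _ _; apply.
by apply: idealB; [|exact: nI|apply: idealB => //; exact: idealB].
Qed.

End Ideals.

(** * Powers of ideals and reductions *)

Section Powers.
Variable A : comNzRingType.
Implicit Types (I J : A -> Prop) (x y g : A).

Lemma ideal_powM I a b x y : is_ideal I ->
  ideal_pow I a x -> ideal_pow I b y -> ideal_pow I (a + b) (x * y).
Proof.
move=> HI; elim: a x => [|a IH] x /=.
  by move=> _; case: (is_ideal_pow b HI) => _ _; apply.
move=> Hx Hy; have [P0 PD _] := is_ideal_pow (a + b).+1 HI.
move: x Hx; apply: ideal_mul_min => [|x z Hx Hz|x z Ix Hz]; rewrite ?mul0r //.
  by rewrite mulrDl; apply: PD.
by rewrite -mulrA; apply: ideal_mul_mem => //; exact: IH.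
Qed.

Lemma ideal_powX I x n : I x -> ideal_pow I n (x ^+ n).
Proof. by move=> Ix; elim: n => //= n IH; rewrite exprS; apply: ideal_mul_mem. Qed.

Lemma ideal_powXk I x k n : is_ideal I -> ideal_pow I k x -> ideal_pow I (k * n) (x ^+ n).
Proof.
move=> HI Hx; elim: n => [|n IH]; first by rewrite muln0.
by rewrite mulnS exprS; apply: ideal_powM.
Qed.

Lemma ideal_powS I J n : is_ideal J -> subset I J -> subset (ideal_pow I n) (ideal_pow J n).
Proof. by move=> HJ IJ; elim: n => // n IH; apply: ideal_mulS. Qed.

Lemma ideal_mul_powM I J a b x y : is_ideal I -> is_ideal J ->
  ideal_mul J (ideal_pow I a) x -> ideal_pow I b y ->
  ideal_mul J (ideal_pow I (a + b)) (x * y).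
Proof.
move=> HI HJ + Hy; have [P0 PD _] := is_ideal_mul (ideal_pow I (a + b)) HJ.
move: x; apply: ideal_mul_min => [|x z Hx Hz|x z Jx Hz]; rewrite ?mul0r //.
  by rewrite mulrDl; apply: PD.
by rewrite -mulrA; apply: ideal_mul_mem => //; exact: ideal_powM.
Qed.

Lemma ideal_mul_pow_sub I J n : is_ideal I -> subset J I ->
  subset (ideal_mul J (ideal_pow I n)) (ideal_pow I n.+1).
Proof. by move=> HI JI; apply: ideal_mulS. Qed.

(** Factors are replaced one at a time; each replacement leaves one factor in [J] and [n - 1]
    factors in [I]. *)
Lemma prod_congr_pow I J n (x y : 'I_n -> A) : is_ideal I -> is_ideal J ->
  (forall i, I (x i)) -> (forall i, I (y i)) -> (forall i, J (x i - y i)) ->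
  ideal_mul J (ideal_pow I n.-1) (\prod_i x i - \prod_i y i).
Proof.
move=> HI HJ; have HP k := is_ideal_mul (ideal_pow I k) HJ.
have prodI k (z : 'I_k -> A) : (forall i, I (z i)) -> ideal_pow I k (\prod_i z i).
  elim: k z => [|k IH] z Hz; first by [].
  by rewrite big_ord_recl; apply: ideal_mul_mem => //; exact: IH.
elim: n x y => [|n IH] x y Ix Iy Jxy.
  by rewrite !big_ord0 subrr; case: (HP 0%N).
rewrite !big_ord_recl /=; set X := \prod_(i < n) _; set Y := \prod_(i < n) _.
have -> : x ord0 * X - y ord0 * Y = (x ord0 - y ord0) * X + (X - Y) * y ord0 by ring.
case: (HP n) => P0 PD _; apply: PD; first by apply: ideal_mul_mem => //; exact: prodI.
(* An empty tail is treated apart, because the truncated [n.-1] then no longer counts the remaining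
   factors. *)
case: n x y Ix Iy Jxy IH @X @Y P0 => [|n] x y Ix Iy Jxy IH X Y P0.
  by rewrite /X /Y !big_ord0 subrr mul0r.
have Hy : ideal_pow I 1 (y ord0) by rewrite -[y ord0]expr1; apply: ideal_powX.
have := ideal_mul_powM HI HJ (IH (fun i => x (lift ord0 i)) (fun i => y (lift ord0 i)) _ _ _) Hy.
by rewrite addn1; apply.
Qed.

Lemma det_congr_pow I J n (M N : 'M[A]_n) : is_ideal I -> is_ideal J ->
  (forall i j, I (M i j)) -> (forall i j, I (N i j)) -> (forall i j, J (M i j - N i j)) ->
  ideal_mul J (ideal_pow I n.-1) (\det M - \det N).
Proof.
move=> HI HJ IM IN JMN; have HP := is_ideal_mul (ideal_pow I n.-1) HJ.
rewrite /determinant -sumrB; apply: ideal_sum => // s _; rewrite -mulrBr.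
by case: (HP) => _ _; apply; apply: prod_congr_pow.
Qed.

(** Expansion of [((g) + (gs))^n] into products of a power of [g] and an element of a power of
    [(gs)]. The target [L] is arbitrary so that the induction can pass to a colon ideal. *)
Lemma ideal_pow_cons (g : A) gs L n : is_ideal L ->
  (forall i j y, (i + j)%N = n -> ideal_pow (ideal_gen gs) j y -> L (g ^+ i * y)) ->
  subset (ideal_pow (ideal_gen (g :: gs)) n) L.
Proof.
elim: n L => [|n IH] L HL Hg.
  by move=> x _; rewrite -[x]mul1r; apply: (Hg 0%N 0%N).
have [L0 LD LM] := HL; apply: ideal_mul_min => // x y Hx Hy.
apply: (IH (colon L x)) => //; first exact: is_ideal_colon.
move=> i j z ij Hz; rewrite /colon.
have [r [x' [Hx' ->]]] : add_principal (ideal_gen gs) g x.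
  move: x Hx; apply: ideal_gen_min; first exact/is_ideal_add_principal/is_ideal_gen.
  move=> h; rewrite inE => /orP[/eqP ->|hgs].
    exact/add_principal_mem/is_ideal_gen.
  exact/add_principalS/ideal_gen_mem.
have -> : (x' + r * g) * (g ^+ i * z) = g ^+ i * (x' * z) + r * (g ^+ i.+1 * z).
  by rewrite exprS; ring.
apply: (LD); first by apply: (Hg i j.+1); [rewrite addnS ij | exact: ideal_mul_mem].
by apply: LM; apply: (Hg i.+1 j) => //; rewrite addSn ij.
Qed.

(** A monomial of high degree in the generators contains some [g] to a power beyond its [e], and
    that power can be traded for an element of [J] times a power of [I]. *)
Lemma reduction_of_generators I J gs : is_ideal I -> is_ideal J -> subset J I ->
  same_set I (ideal_gen gs) ->
  (forall g, g \in gs -> exists e, ideal_mul J (ideal_pow I e) (g ^+ e.+1)) ->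
  is_reduction J I.
Proof.
move=> HI HJ JI Igs Hgs.
have HP k := is_ideal_mul (ideal_pow I k) HJ.
have [M HM] : exists M, forall j, (M <= j)%N ->
    subset (ideal_pow (ideal_gen gs) j.+1) (ideal_mul J (ideal_pow I j)).
  have sub : forall g, g \in gs -> I g by move=> g ggs; apply/Igs/ideal_gen_mem.
  elim: gs Hgs sub {Igs} => [|g gs IH] Hgs sub.
    exists 0%N => j _; case: (HP j) => P0 PD PM; apply: ideal_mul_min => // x y.
    by move=> /ideal_genP[c ->]; rewrite big_ord0 mul0r.
  have [||M HM] := IH.
  - by move=> h hgs; apply: Hgs; rewrite inE hgs orbT.
  - by move=> h hgs; apply: sub; rewrite inE hgs orbT.
  have [e He] := Hgs g (mem_head _ _); have Ig := sub g (mem_head _ _).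
  have subgs : subset (ideal_gen gs) I.
    by apply: ideal_gen_min => // h hgs; apply: sub; rewrite inE hgs orbT.
  exists (e + M)%N => j lej; apply: ideal_pow_cons => // i k y ik Hy.
  (* Either [g] occurs to a power above [e], or at most [e] factors are [g] and the rest has degree
     above [M]. *)
  case: (leqP e.+1 i) => ei.
    rewrite -(subnKC ei) exprD -mulrA.
    have -> : j = (e + ((i - e.+1) + k))%N.
      by apply: succn_inj; rewrite -ik -addSn addnA subnKC.
    apply: ideal_mul_powM => //; apply: ideal_powM => //; first exact: ideal_powX.
    exact: ideal_powS Hy.
  case: k ik Hy => [|k] ik Hy.
    by move: lej; rewrite -ltnS -ik addn0 ltnNge (leq_trans (ei : (i <= e)%N)) ?leq_addr.
  have {ik} ik : (k + i)%N = j by apply: succn_inj; rewrite -ik addnS addnC.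
  have Mk : (M <= k)%N.
    rewrite -(leq_add2l e); apply: (leq_trans lej); rewrite -ik addnC leq_add2r.
    by rewrite -ltnS.
  by rewrite mulrC -ik; apply: ideal_mul_powM => //; [exact: HM | exact: ideal_powX].
split=> //; exists (maxn M 1); split; first by rewrite leq_max orbT.
move=> x; split; last exact: ideal_mul_pow_sub.
move=> Hx; apply: HM; first exact: leq_maxl.
move: Hx; apply: ideal_powS; first exact: is_ideal_gen.
by move=> y /Igs.
Qed.

End Powers.

(** * One-dimensional local rings with finite residue field *)

Section LocalRing.
Variables (A : comNzRingType) (m : A -> Prop).
Hypothesis noethA : noetherian A.
Hypothesis localA : local_with_max m.

Lemma local_ideal : is_ideal m.
Proof. by case: localA => [[[]]]. Qed.

Lemma local_not1 : ~ m 1.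
Proof. by case: localA => [[[]]]. Qed.

Lemma proper_sub_local I : proper_ideal I -> subset I m.
Proof.
move=> /(exists_maximal noethA)[M HM IM] x /IM Mx.
by case: localA => _ /(_ M HM)/(_ x)[+ _]; apply.
Qed.

Lemma local_unit a : ~ m a -> exists b, a * b = 1.
Proof.
move=> na; apply: contrapT => nb; apply: na.
apply: (@proper_sub_local (ideal_gen [:: a])).
  split; first exact: is_ideal_gen.
  by move=> /ideal_genP[c]; rewrite big_ord1 /= mulrC => E; apply: nb; exists (c 0%N).
exact/ideal_gen_mem/mem_head.
Qed.

Lemma local_prime : prime_ideal m.
Proof.
have HI := local_ideal; split; first by split=> //; exact: local_not1.
move=> a b Mab; apply: contrapT => /not_orP[/local_unit[c ac1]]; apply.
have -> : b = c * (a * b) by rewrite mulrA [c * a]mulrC ac1 mul1r.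
by case: HI => _ _; apply.
Qed.

Section DimensionOne.
Hypothesis dimA : krull_dim_one A.

(* A prime contained in [P] and avoiding [c] would start a chain of length two. *)
Lemma prime_of_nzd_red P c : prime_ideal P -> P c -> nzd_red c -> subset m P.
Proof.
move=> HP Pc nc; apply: contrapT => nmP; case: dimA => _; apply.
have [[idP P1] PP] := HP.
(* A prime that avoids [S] lies inside [P], by the elements with [i = 0], and does not contain
   [c]. *)
pose S x := exists i s, ~ P s /\ x = c ^+ i * s.
have [|||P0 HP0 dP0] := @exists_prime_avoiding _ noethA S.
- by exists 0%N, 1; rewrite mul1r.
- move=> _ _ [i [s [ns ->]]] [j [t [nt ->]]]; exists (i + j)%N, (s * t); split.
    by move=> /PP[].
  by rewrite exprD; ring.
- move=> [i [s [ns E]]]; apply: ns; apply: prime_nilp => //.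
  by apply: (nzd_redX (n := i) nc); rewrite -E; exact: nilp0.
exists P0, P, m; split=> //; first exact: local_prime.
  split; last by move=> /(_ c Pc) /dP0; apply; exists 1%N, 1; rewrite mulr1.
  by move=> x /dP0 nS; apply: contrapT => nPx; apply: nS; exists 0%N, x; rewrite mul1r.
by split=> //; apply: proper_sub_local.
Qed.

(** The chain of two primes provides a non-nilpotent [g] in [m]. Adding a complement [z] makes it
    regular, and [z] is in [m] too: a unit [z] with [g * z] nilpotent would make [g] nilpotent. *)
Lemma exists_nzd_red_max : exists2 x, m x & nzd_red x.
Proof.
case: dimA => [[P [P' [HP HP' [sPP' nP'P]]]] _].
have [g P'g nPg] : exists2 g, P' g & ~ P g.
  by apply: contrapT => H; apply: nP'P => x P'x; apply: contrapT => nPx; apply: H; exists x.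
have ng : ~ nilp g by move=> /(prime_nilp HP).
have mg : m g by apply: (@proper_sub_local P') => //; case: HP'.
have [z [gz nz]] := nzd_red_complement noethA g.
exists (g + z) => //; case: local_ideal => _ HD _; apply: (HD) => //.
apply: contrapT => /local_unit[w zw]; apply: ng.
by rewrite -[g]mulr1 -zw mulrA; apply: nilpMr.
Qed.

Lemma finite_quotient_nzd_red (I : A -> Prop) c : finite_quotient m -> is_ideal I -> I c ->
  nzd_red c -> finite_quotient I.
Proof.
move=> fm HI Ic nc; apply: finite_quotient_of_primes => // P HP IP.
by apply: finite_quotientS fm; apply: (prime_of_nzd_red HP _ nc); exact: IP.
Qed.

End DimensionOne.
Section ResidueField.
Variables (q : nat) (sg : 'I_q -> A).
Hypothesis sg_inj : forall i j, m (sg i - sg j) -> i = j.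
Hypothesis sg_cov : forall x, exists i, m (x - sg i).

Lemma residue_card_gt1 : (1 < q)%N.
Proof.
have [i Hi] := sg_cov 0; have [j Hj] := sg_cov 1.
have nij : i <> j.
  move=> E; apply: local_not1; rewrite -E in Hj.
  have -> : 1 = (1 - sg i) - (0 - sg i) by ring.
  by apply: idealB => //; exact: local_ideal.
rewrite ltnNge; apply/negP => q1; apply: nij; apply/val_inj.
by case: i j {Hi Hj} => [[|i] Hi] [[|j] Hj] //=; have := leq_trans Hi q1; have := leq_trans Hj q1.
Qed.

Lemma finite_quotient_local : finite_quotient m.
Proof.
exists [seq sg i | i <- enum 'I_q] => a; have [i Hi] := sg_cov a.
by exists (sg i) => //; apply: map_f; rewrite mem_enum.
Qed.

(** The number of points of the projective space of an [n]-dimensional vector space over [k]. *)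
Definition geom n := (\sum_(i < n) q ^ i)%N.

Lemma geomS n : geom n.+1 = (1 + q * geom n)%N.
Proof.
rewrite /geom big_ord_recl expn0; congr addn; rewrite big_distrr /=.
by apply: eq_bigr => i _; rewrite -expnS.
Qed.

(** * Elements of an ideal outside given submodules *)

Section AvoidSubmodules.
Variables (gs : seq A) (N : nat) (H : 'I_N -> A -> Prop).

Local Notation k := (size gs).
Local Notation T := {ffun 'I_k -> 'I_q}.
Let vec (t : T) : A := \sum_(i < k) sg (t i) * gs`_i.
Let fib i : {set T} := [set t | `[< H i (vec t) >]].

(** Fix all coordinates but that of a generator [g] outside [H i]. At most one residue then puts
    [vec t] in [H i], since two of them would make a unit multiple of [g] a member. Overwriting this
    coordinate therefore embeds ['I_q] times the fibre in [T]. *)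
Lemma card_submodule_fiber i : is_ideal (H i) -> (exists2 g, g \in gs & ~ H i g) ->
  (q * #|fib i| <= #|T|)%N.
Proof.
move=> HI [g ggs nHg]; have lt : (index g gs < k)%N by rewrite index_mem.
pose j := Ordinal lt.
pose f (ct : 'I_q * T) : T := [ffun l => if l == j then ct.1 else ct.2 l].
have inj : {in setX [set: 'I_q] (fib i) &, injective f}.
  move=> [c t] [d u]; rewrite !inE /= => /asboolP Ht /asboolP Hu /ffunP E.
  have Ej := E j; rewrite !ffunE eqxx /= in Ej.
  have Eo l : l != j -> t l = u l by move=> nl; have := E l; rewrite !ffunE (negPf nl).
  congr pair => //; apply/ffunP => l; have [->|/Eo //] := eqVneq l j.
  apply: sg_inj; apply: contrapT => /local_unit[b Hb]; apply: nHg.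
  have := idealB HI Ht Hu; rewrite /vec -sumrB (bigD1 j) //= big1 ?addr0; last first.
    by move=> o /Eo ->; rewrite subrr.
  rewrite -mulrBl nth_index // => /(fun h => let: And3 _ _ M := HI in M b _ h).
  by rewrite mulrA [b * _]mulrC Hb mul1r.
rewrite -[X in (X * _)%N](card_ord q) -cardsT -cardsX -(card_in_imset inj).
exact: max_card.
Qed.

(** Double counting of the pairs [(t, i)] with [vec t] in [H i]. On average a vector meets at most
    [#|S| / q] of the submodules; the vector of zero residues lies in all of them, above the
    average, so another vector lies strictly below. *)
Lemma exists_avoiding_element (S : {set 'I_N}) :
  (forall i, i \in S -> is_ideal (H i)) ->
  (forall i a g, i \in S -> m a -> g \in gs -> H i (a * g)) ->
  (forall i, i \in S -> exists2 g, g \in gs & ~ H i g) -> S != set0 ->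
  exists2 x, ideal_gen gs x & (q * #|[set i in S | `[< H i x >]]| < #|S|)%N.
Proof.
move=> HI Hm Hn /set0Pn[i0 i0S]; have q1 := residue_card_gt1.
have vecI t : ideal_gen gs (vec t).
  apply: ideal_sum; first exact: is_ideal_gen.
  by move=> i _; case: (is_ideal_gen gs) => _ _; apply; apply/ideal_gen_mem/mem_nth.
pose D t := [set i in S | `[< H i (vec t) >]].
suff [t Ht] : exists t, (q * #|D t| < #|S|)%N by exists (vec t).
have [z0 Hz0] := sg_cov 0; pose t0 : T := [ffun=> z0].
have Ht0 i : i \in S -> H i (vec t0).
  move=> iS; apply: ideal_sum; first exact: HI.
  move=> l _; apply: Hm => //; last exact: mem_nth.
  by have := idealN local_ideal Hz0; rewrite ffunE sub0r opprK.
apply: contrapT => Hno.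
have le t : (#|S| <= q * #|D t|)%N by rewrite leqNgt; apply/negP => ?; apply: Hno; exists t.
have dbl : (\sum_t #|D t| = \sum_(i in S) #|fib i|)%N.
  transitivity (\sum_t \sum_(i in S) (`[< H i (vec t) >] : nat))%N.
    apply: eq_bigr => t _; rewrite -sum1_card big_mkcond [RHS]big_mkcond /=.
    by apply: eq_bigr => i _; rewrite inE; case: (i \in S); case: asbool.
  rewrite exchange_big; apply: eq_bigr => i _; rewrite -sum1_card [RHS]big_mkcond /=.
  by apply: eq_bigr => t _; rewrite inE; case: asbool.
have Dt0 : #|D t0| = #|S|.
  by apply: eq_card => i; rewrite inE; case: (boolP (i \in S)) => //= /Ht0 ?; apply/asboolP.
have up : (q * \sum_t #|D t| <= #|S| * #|T|)%N.
  rewrite dbl big_distrr /= -sum_nat_const; apply: leq_sum => i iS.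
  by apply: card_submodule_fiber; [exact: HI | exact: Hn].
have lo : (q * #|S| + #|S| * (#|T|.-1) <= q * \sum_t #|D t|)%N.
  rewrite (bigD1 t0) //= mulnDr Dt0 leq_add2l big_distrr /=.
  apply: (@leq_trans (\sum_(t | t != t0) #|S|)%N); last by apply: leq_sum => t _.
  by rewrite sum_nat_const mulnC leq_mul2r cardC1 leqnn orbT.
have := leq_trans lo up; have T0 : (0 < #|T|)%N by apply/card_gt0P; exists t0.
have S0 : (0 < #|S|)%N by apply/card_gt0P; exists i0.
rewrite -[in X in (_ <= X)%N -> _](prednK T0) mulnS leq_add2r leqNgt => /negP; apply.
by rewrite -[X in (X < _)%N]mul1n ltn_mul2r S0.
Qed.

(** Greedy choice: each new element lies in fewer than a [q]-th of the submodules that remain, and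
    the recursion [geomS] turns the bound for [n.+1] elements into the bound for [n]. *)
Lemma exists_avoiding_family n (S : {set 'I_N}) :
  (forall i, i \in S -> is_ideal (H i)) ->
  (forall i a g, i \in S -> m a -> g \in gs -> H i (a * g)) ->
  (forall i, i \in S -> exists2 g, g \in gs & ~ H i g) -> (#|S| < geom n.+1)%N ->
  exists a : seq A, [/\ size a = n, forall x, x \in a -> ideal_gen gs x &
    forall i, i \in S -> exists2 x, x \in a & ~ H i x].
Proof.
elim: n S => [|n IH] S HI Hm Hn.
  rewrite geomS /geom big_ord0 muln0 addn0 ltnS leqn0 cards_eq0 => /eqP ->.
  by exists [::]; split=> // i; rewrite inE.
move=> SG.
have [x xI xS] : exists2 x, ideal_gen gs x & (#|[set i in S | `[< H i x >]]| < geom n.+1)%N.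
  have [S0|nS] := eqVneq S set0.
    exists 0; first by case: (is_ideal_gen gs).
    rewrite geomS add1n ltnS (_ : [set _ in _ | _] = set0) ?cards0 //.
    by apply/setP => i; rewrite S0 !inE.
  have [x xI xS] := exists_avoiding_element HI Hm Hn nS; exists x => //.
  move: SG; rewrite geomS add1n ltnS => /(leq_trans xS).
  by rewrite ltn_mul2l => /andP[].
have [|||a [sa aI aS]] := IH [set i in S | `[< H i x >]] _ _ _ xS.
- by move=> i; rewrite inE => /andP[/HI].
- by move=> i b g; rewrite inE => /andP[iS _]; exact: Hm.
- by move=> i; rewrite inE => /andP[/Hn].
exists (x :: a); split=> /=; first by rewrite sa.
  by move=> y; rewrite inE => /orP[/eqP ->|/aI].
move=> i iS; have [Hx|nHx] := pselect (H i x).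
  have [|y ya nHy] := aS i; first by rewrite inE iS; apply/asboolP.
  by exists y => //; rewrite inE ya orbT.
by exists x => //; exact: mem_head.
Qed.

End AvoidSubmodules.

(** * Points of projective space over the residue field *)

Fixpoint residue_vectors n : seq (seq A) :=
  if n is n'.+1 then [seq sg i :: w | i <- enum 'I_q, w <- residue_vectors n'] else [:: [::]].

(** Homogeneous coordinates normalised so that the first nonzero one is 1. *)
Fixpoint projective_points n : seq (seq A) :=
  if n is n'.+1 then
    [seq 1 :: w | w <- residue_vectors n'] ++ [seq 0 :: w | w <- projective_points n']
  else [::].

Lemma size_residue_vectors n : size (residue_vectors n) = (q ^ n)%N.
Proof. by elim: n => //= n IH; rewrite size_allpairs IH size_enum_ord expnS. Qed.

Lemma size_projective_points n : size (projective_points n) = geom n.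
Proof.
elim: n => [|n IH] /=; first by rewrite /geom big_ord0.
by rewrite size_cat !size_map IH size_residue_vectors /geom big_ord_recr addnC.
Qed.

Lemma residue_vectorsP n (p : nat -> A) :
  exists2 w, w \in residue_vectors n & forall j, (j < n)%N -> m (p j - w`_j).
Proof.
elim: n p => [|n IH] p; first by exists [::]; rewrite ?inE.
have [w ww Hw] := IH (fun j => p j.+1); have [i Hi] := sg_cov (p 0%N).
exists (sg i :: w); last by case.
by apply: allpairs_f => //; rewrite mem_enum.
Qed.

Lemma projective_pointsP n (p : nat -> A) : (exists2 j, (j < n)%N & ~ m (p j)) ->
  exists u w, w \in projective_points n /\ forall j, (j < n)%N -> m (u * p j - w`_j).
Proof.
elim: n p => [|n IH] p [j jn nj] //=.
have [mp|/local_unit[b pb]] := pselect (m (p 0%N)).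
  have [|u [w [ww Hw]]] := IH (fun j => p j.+1).
    by case: j jn nj => // j jn nj; exists j.
  exists u, (0 :: w); split; first by rewrite mem_cat map_f ?orbT.
  case=> [_|j' j'n]; last exact: Hw.
  by rewrite subr0; case: local_ideal => _ _; apply.
have [w ww Hw] := residue_vectorsP n (fun j => b * p j.+1).
exists b, (1 :: w); split; first by rewrite mem_cat map_f.
case=> [_|j' j'n]; last exact: Hw.
by rewrite /= mulrC pb subrr; case: local_ideal.
Qed.

Lemma projective_points_unit n w : w \in projective_points n ->
  exists2 j, (j < n)%N & w`_j = 1.
Proof.
elim: n w => [|n IH] w //=; rewrite mem_cat => /orP[] /mapP[v Hv ->]; first by exists 0%N.
by have [j jn E] := IH v Hv; exists j.+1.
Qed.

(** That [n] linear forms in [n.+1] variables over [k] have a common nontrivial zero is obtained by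
    counting: the [q ^ n.+1] vectors have at most [q ^ n] images, and the difference of two with the
    same image is a zero. *)
Lemma residue_kernel_vector n (c : nat -> nat -> A) :
  exists2 p : nat -> A, (exists2 j, (j < n.+1)%N & ~ m (p j)) &
    forall l, (l < n)%N -> m (\sum_(j < n.+1) c l j * p j).
Proof.
pose r x := sval (cid (sg_cov x)).
have rP x : m (x - sg (r x)) by rewrite /r; case: cid.
pose f (t : {ffun 'I_n.+1 -> 'I_q}) : {ffun 'I_n -> 'I_q} :=
  [ffun l : 'I_n => r (\sum_(j < n.+1) c l j * sg (t j))].
have : ~ injective f.
  move=> /leq_card; rewrite !card_ffun !card_ord leqNgt ltn_exp2l ?residue_card_gt1 //.
  by rewrite ltnSn.
move=> /existsNP[t] /existsNP[u] /not_implyP[/ffunP E ntu].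
exists (fun j => sg (t (inord j)) - sg (u (inord j))).
  apply: contrapT => Hno; apply: ntu; apply/ffunP => j; apply: sg_inj.
  by apply: contrapT => Hj; apply: Hno; exists j => //; rewrite inord_val.
move=> l ln; have := E (Ordinal ln); rewrite !ffunE /= => El.
have Hm := local_ideal.
have := idealB Hm (rP (\sum_(j < n.+1) c l j * sg (t j))) (rP (\sum_(j < n.+1) c l j * sg (u j))).
rewrite El opprB addrA subrK -sumrB; congr m; apply: eq_bigr => j _.
by rewrite inord_val mulrBr.
Qed.

End ResidueField.
End LocalRing.

(** * The integral closure and its maximal ideals *)

Section TotalQuotientRing.
Variables (A : comNzRingType) (m : A -> Prop) (Q : comNzRingType).
Variable phi : {rmorphism A -> Q}.
Hypothesis noethA : noetherian A.
Hypothesis localA : local_with_max m.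
(** These three properties say that [Q] is the total quotient ring of [A_red]; a concrete model is
    built further on. *)
Hypothesis ker_phi : forall a, phi a = 0 <-> nilp a.
Hypothesis inv_phi : forall s, nzd_red s -> exists t, phi s * t = 1.
Hypothesis frac_phi : forall z, exists s a, nzd_red s /\ phi s * z = phi a.

Local Notation B := (integralOver phi).

Definition cl_idealQ (K : Q -> Prop) :=
  [/\ forall z, K z -> B z, K 0, forall y z, K y -> K z -> K (y + z) &
      forall r z, B r -> K z -> K (r * z)].
Definition cl_maxQ K :=
  [/\ cl_idealQ K, ~ K 1 &
      forall K', cl_idealQ K' -> ~ K' 1 -> (forall z, K z -> K' z) -> forall z, K' z -> K z].

Lemma closure1 : B 1. Proof. exact: integral1. Qed.
Lemma closure0 : B 0. Proof. exact: integral0. Qed.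
Lemma closure_phi a : B (phi a). Proof. exact: integral_id. Qed.
Lemma closureX z n : B z -> B (z ^+ n).
Proof.
by move=> Bz; elim: n => [|n IH]; [exact: closure1 | rewrite exprS; exact: integral_mul].
Qed.
Lemma closure_sum (T : Type) (r : seq T) (P : pred T) (F : T -> Q) :
  (forall i, P i -> B (F i)) -> B (\sum_(i <- r | P i) F i).
Proof. by move=> HF; apply: big_ind => //; [exact: closure0 | exact: integral_add]. Qed.

Lemma cl_idealN K z : cl_idealQ K -> K z -> K (- z).
Proof.
case=> _ _ _ KM Kz; rewrite -mulN1r; apply: KM => //; apply: integral_opp; exact: closure1.
Qed.

Lemma cl_idealB K y z : cl_idealQ K -> K y -> K z -> K (y - z).
Proof. by move=> HK Ky /(cl_idealN HK); case: HK => _ _ KD _; exact: KD. Qed.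

Lemma cl_ideal_sum K (T : Type) (r : seq T) (P : pred T) (F : T -> Q) :
  cl_idealQ K -> (forall i, P i -> K (F i)) -> K (\sum_(i <- r | P i) F i).
Proof. by case=> _ K0 KD _ HF; apply: big_ind. Qed.

Lemma cl_max_comax K b : cl_maxQ K -> B b -> ~ K b ->
  exists w k, [/\ B w, K k & 1 = k + w * b].
Proof.
move=> [HK nK1 maxK] Bb nKb; have [KB K0 KD KM] := HK.
pose K' z := exists w k, [/\ B w, K k & z = k + w * b].
apply: contrapT => nK'1; apply: nKb; apply: (maxK K') => //.
- split.
  + move=> _ [w [k [Bw Kk ->]]]; apply: integral_add; first exact: KB.
    exact: integral_mul.
  + by exists 0, 0; split=> //; [exact: closure0 | ring].
  + move=> _ _ [w [k [Bw Kk ->]]] [w' [k' [Bw' Kk' ->]]].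
    exists (w + w'), (k + k'); split; [exact: integral_add | exact: KD | ring].
  + move=> r _ Br [w [k [Bw Kk ->]]]; exists (r * w), (r * k).
    by split; [exact: integral_mul | exact: KM | ring].
- by move=> z Kz; exists 0, z; split=> //; [exact: closure0 | ring].
- by exists 1, 0; split=> //; [exact: closure1 | ring].
Qed.

Lemma cl_max_prime K a b : cl_maxQ K -> B a -> B b -> K (a * b) -> K a \/ K b.
Proof.
move=> HK Ba Bb Kab; apply: contrapT => /not_orP[nKa]; apply.
have [w [k [Bw Kk E]]] := cl_max_comax HK Ba nKa.
case: HK => [[KB K0 KD KM] _ _].
rewrite -[b]mul1r E mulrDl; apply: KD; first by rewrite mulrC; exact: KM.
by rewrite -mulrA; apply: KM.
Qed.

Lemma cl_max_notM K a b : cl_maxQ K -> B a -> B b -> ~ K a -> ~ K b -> ~ K (a * b).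
Proof. by move=> HK Ba Bb nKa nKb /(cl_max_prime HK Ba Bb)[]. Qed.

Lemma cl_max_notX K a n : cl_maxQ K -> B a -> ~ K a -> ~ K (a ^+ n).
Proof.
move=> HK Ba nKa; elim: n => [|n IH]; first by case: HK.
by rewrite exprS; apply: cl_max_notM => //; exact: closureX.
Qed.

(* If [1 - phi a * w] lay in [K] with [a] in [m], clearing denominators in an integral equation for
   [w] would put the image of a unit of [A] in [K]. *)
Lemma cl_max_local K a : cl_maxQ K -> m a -> K (phi a).
Proof.
move=> HK ma; apply: contrapT => nKa.
have [w [k [[p mon_p /eqP pw] Kk E]]] := cl_max_comax HK (closure_phi a) nKa.
have Bw : B w by exists p => //; exact/eqP.
case: (HK) => [HI nK1 _]; have [KB K0 KD KM] := HI.
pose t := w * phi a.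
have Bt : B t by apply: integral_mul => //; exact: closure_phi.
have Kt i : K (1 - t ^+ i).
  elim: i => [|i IH]; first by rewrite subrr.
  have -> : 1 - t ^+ i.+1 = t ^+ i * (1 - t) + (1 - t ^+ i) by rewrite exprS; ring.
  apply: KD => //; apply: KM; first exact: closureX.
  by rewrite E addrK.
pose d := (size p).-1.
have szp : size p = d.+1 by rewrite prednK // lt0n size_poly_eq0 monic_neq0.
have pd : p`_d = 1 by move: mon_p; rewrite monicE lead_coefE => /eqP.
(* The integral equation of [w] multiplied by [phi a ^+ d]. Replacing the powers of [t] by 1 modulo
   [K] turns its left side into the image of an element of [1 + m]. *)
have E0 : \sum_(i < d.+1) phi (p`_i * a ^+ (d - i)) * t ^+ i = 0.
  have -> : \sum_(i < d.+1) phi (p`_i * a ^+ (d - i)) * t ^+ i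
            = phi a ^+ d * (map_poly phi p).[w].
    rewrite (@horner_coef_wide _ d.+1) ?size_map_poly_id0 ?szp //; last first.
      by rewrite (monicP mon_p) rmorph1 oner_eq0.
    rewrite mulr_sumr; apply: eq_bigr => i _; rewrite coef_map rmorphM rmorphXn.
    have -> : phi a ^+ d = phi a ^+ (d - i) * phi a ^+ i by rewrite -exprD subnK // -ltnS.
    by rewrite exprMn; ring.
  by rewrite pw mulr0.
have K1 : K (phi (\sum_(i < d.+1) p`_i * a ^+ (d - i))).
  rewrite rmorph_sum; set S := \sum_(i < _) _.
  have -> : S = S - \sum_(i < d.+1) phi (p`_i * a ^+ (d - i)) * t ^+ i by rewrite E0 subr0.
  rewrite -sumrB; apply: cl_ideal_sum => // i _.
  have -> : phi (p`_i * a ^+ (d - i)) - phi (p`_i * a ^+ (d - i)) * t ^+ i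
          = phi (p`_i * a ^+ (d - i)) * (1 - t ^+ i) by ring.
  by apply: KM => //; exact: closure_phi.
have Hm := local_ideal localA; have [m0 mD mM] := Hm.
have [|b ub] := local_unit noethA localA (a := \sum_(i < d.+1) p`_i * a ^+ (d - i)).
  rewrite big_ord_recr /= subnn expr0 mulr1 pd => H.
  apply: (local_not1 localA); set S := \sum_(i < d) _ in H.
  have mS : m S.
    apply: ideal_sum => // i _; apply: (mM).
    by rewrite -(subnSK (ltn_ord i)) exprS; apply: idealMr.
  by rewrite -[1](addKr S) addrC; apply: idealB.
apply: nK1; rewrite -(rmorph1 phi) -ub rmorphM mulrC; apply: KM => //; exact: closure_phi.
Qed.

Lemma cl_max_local_iff K a : cl_maxQ K -> K (phi a) <-> m a.
Proof.
move=> HK; split; last exact: cl_max_local.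
move=> Ka; apply: contrapT => /(local_unit noethA localA)[b ab1].
case: HK => [[KB K0 KD KM] nK1 _]; apply: nK1.
by rewrite -(rmorph1 phi) -ab1 rmorphM mulrC; apply: KM => //; exact: closure_phi.
Qed.

Lemma cl_max_exists J : cl_idealQ J -> ~ J 1 ->
  exists2 K, cl_maxQ K & forall z, J z -> K z.
Proof.
move=> HJ nJ1.
(* The variable part [X] is kept apart from [J], so that the empty chain, whose union is empty, is
   admissible as well. *)
pose P (X : Q -> Prop) := cl_idealQ (fun z => J z \/ X z) /\ ~ X 1.
have [F FP Ftot|X [[HX nX1] maxX]] := @classical_sets.Zorn_bigcup Q P.
  have [JB J0 JD JM] := HJ.
  have common y z : (J y \/ exists2 X, F X & X y) -> (J z \/ exists2 X, F X & X z) ->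
      (J y /\ J z) \/ exists2 X, F X & (J y \/ X y) /\ (J z \/ X z).
    move=> [Jy|[X FX Xy]] [Jz|[Y FY Yz]]; first by left.
    - by right; exists Y => //; split; [left|right].
    - by right; exists X => //; split; [right|left].
    - have [XY|YX] := Ftot _ _ FX FY; [right; exists Y|right; exists X] => //.
        by split; right => //; exact: XY.
      by split; right => //; exact: YX.
  split; last by move=> [X FX X1]; case: (FP X FX).
  split.
  - by move=> z [/JB //|[X FX Xz]]; case: (FP X FX) => [[XB _ _ _] _]; apply: XB; right.
  - by left.
  - move=> y z Hy Hz; case: (common _ _ Hy Hz) => [[Jy Jz]|[X FX [Xy Xz]]]; first by left; exact: JD.
    case: (FP X FX) => [[_ _ XD _] _]; case: (XD _ _ Xy Xz); first by left.
    by right; exists X.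
  - move=> r z Br [Jz|[X FX Xz]]; first by left; exact: JM.
    case: (FP X FX) => [[_ _ _ XM] _]; case: (XM r z Br (or_intror Xz)); first by left.
    by right; exists X.
exists (fun z => J z \/ X z); last by left.
split=> //; first by case.
move=> K HK nK1 XK z Kz.
have [//|nXz] := pselect (J z \/ X z).
case: (maxX K).
  split; first by move=> y Xy; apply: XK; right.
  by move=> /(_ z Kz) Xz; apply: nXz; right.
split=> //; case: HK => KB K0 KD KM.
have JK y : J y \/ K y -> K y by case=> // Jy; apply: XK; left.
split.
- by move=> y /JK /KB.
- by right.
- by move=> y1 y2 /JK H1 /JK H2; right; exact: KD.
- by move=> r y Br /JK H; right; exact: KM.
Qed.

Lemma cl_ideal0 : cl_idealQ (fun z => z = 0).
Proof.
split=> // [z ->|y z -> ->|r z _ ->]; rewrite ?addr0 ?mulr0 //; exact: closure0.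
Qed.

(** For [j <> i] some element of [Ks j] is congruent to 1 modulo [Ks i]; the product of these over
    [j] is the required [e i]. *)
Lemma cl_max_crt M (Ks : 'I_M -> Q -> Prop) : (forall i, cl_maxQ (Ks i)) ->
  (forall i j, (forall z, Ks i z <-> Ks j z) -> i = j) ->
  exists e : 'I_M -> Q, forall i, [/\ B (e i), Ks i (1 - e i) &
    forall j, j <> i -> Ks j (e i)].
Proof.
move=> HK dist.
have sep i j : exists a, [/\ B a, Ks i (1 - a) & j <> i -> Ks j a].
  have [[KB K0 KD KM] nK1 maxK] := HK i.
  have [->|/eqP nij] := eqVneq j i; first by exists 1; split=> //; [exact: closure1 | rewrite subrr].
  have [a Ka nKa] : exists2 a, Ks j a & ~ Ks i a.
    apply: contrapT => H; apply: nij; apply: dist => z; case: (HK j) => [HKj nKj1 maxKj].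
    have sub y : Ks j y -> Ks i y.
      by move=> Hy; apply: contrapT => Hn; apply: H; exists y.
    by split; [exact: sub|move=> Hz; apply: (maxKj (Ks i)) => //; case: (HK i)].
  case: (HK j) => [[KjB _ _ KjM] _ _].
  have [w [k [Bw Kk E]]] := cl_max_comax (HK i) (KjB _ Ka) nKa.
  exists (w * a); split; first by apply: integral_mul => //; exact: KjB.
    by rewrite E addrK.
  by move=> _; exact: KjM.
pose a i j := sval (cid (sep i j)).
have aP i j : [/\ B (a i j), Ks i (1 - a i j) & j <> i -> Ks j (a i j)].
  by rewrite /a; case: cid.
have BP i (P : pred 'I_M) : B (\prod_(j | P j) a i j).
  by apply: big_ind; [exact: closure1 | exact: integral_mul | move=> j _; case: (aP i j)].
exists (fun i => \prod_j a i j) => i; have [[KB K0 KD KM] _ _] := HK i; split.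
- exact: BP.
- suff [_ +] : B (\prod_j a i j) /\ Ks i (1 - \prod_j a i j) by [].
  apply: (big_rec (fun z => B z /\ Ks i (1 - z))); first by split; [exact: closure1 | rewrite subrr].
  move=> j z _ [Bz Kz]; case: (aP i j) => Ba Ka _; split; first exact: integral_mul.
  have -> : 1 - a i j * z = (1 - a i j) + a i j * (1 - z) by ring.
  by apply: (KD) => //; exact: KM.
- move=> j nji; rewrite (bigD1 j) //= mulrC; case: (HK j) => [[_ _ _ KjM] _ _].
  by apply: KjM; [exact: BP | case: (aP i j) => _ _; apply].
Qed.

Lemma common_denominator M (e : 'I_M -> Q) :
  exists c (y : 'I_M -> A), nzd_red c /\ forall i, phi c * e i = phi (y i).
Proof.
pose s i := sval (cid (frac_phi (e i))).
have sP i : exists a, nzd_red (s i) /\ phi (s i) * e i = phi a by rewrite /s; case: cid.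
pose a i := sval (cid (sP i)).
have aP i : nzd_red (s i) /\ phi (s i) * e i = phi (a i) by rewrite /a; case: cid.
exists (\prod_i s i), (fun i => (\prod_(j | j != i) s j) * a i); split.
  apply: big_ind => [x|x y|i _]; [by rewrite mul1r | exact: nzd_redM | by case: (aP i)].
by move=> i; rewrite (bigD1 i) //= !rmorphM -(proj2 (aP i)); ring.
Qed.

(** * Counting modulo a regular element, and the finiteness of the set of maximal ideals *)

Section FiniteResidueField.
Variables (q : nat) (sg : 'I_q -> A).
Hypothesis dimA : krull_dim_one A.
Hypothesis sg_inj : forall i j, m (sg i - sg j) -> i = j.
Hypothesis sg_cov : forall x, exists i, m (x - sg i).

Let residue_card_gt1 := residue_card_gt1 localA sg_cov.
Let finite_quotient_local := finite_quotient_local sg_cov.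

(** The bound [L] comes from [A_red / xA_red] alone and serves every [I] at once: as soon as the
    [q ^ k] combinations of [k] elements of [I] outnumber it, two of them agree modulo [xI]. *)
Lemma residue_collision : exists x L, m x /\
  forall (I : A -> Prop) k (y : 'I_k -> A), is_ideal I -> subset (@nilp A) I ->
  (exists2 c, I c & nzd_red c) -> (forall i, I (y i)) -> (L < q ^ k)%N ->
  exists t u : {ffun 'I_k -> 'I_q}, t <> u /\
  exists2 w, I w & phi (\sum_i (sg (t i) - sg (u i)) * y i) = phi x * phi w.
Proof.
have [x mx nx] := exists_nzd_red_max noethA localA dimA.
have [s Hs] : finite_quotient (add_principal (@nilp A) x).
  have HN := is_ideal_nilp A.
  apply: (finite_quotient_nzd_red noethA localA dimA finite_quotient_local _ _ nx).
    exact: is_ideal_add_principal.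
  exact: add_principal_mem.
exists x, (size s); split=> // I k y HI nI [c Ic nc] Iy Lk.
have [||||t [u [ntu [w Iw Hw]]]] := @incongruent_family_bound A I x _
   {ffun 'I_k -> 'I_q} (fun t => \sum_i sg (t i) * y i) s HI nI _ (erefl _).
- exact: finite_quotient_nzd_red finite_quotient_local HI Ic nc.
- move=> a; have [r rs [b [n [Hn E]]]] := Hs a; exists r => //; exists b.
  by rewrite E [x * b]mulrC addrK.
- by rewrite card_ffun !card_ord.
- by move=> t; apply: ideal_sum => // i _; case: (HI) => _ _; apply.
exists t, u; split=> //; exists w => //; apply/eqP; rewrite -subr_eq0 -rmorphM -rmorphB.
apply/eqP/ker_phi; congr (nilp _): Hw; congr (_ - _).
by rewrite -sumrB; apply: eq_bigr => i _; rewrite mulrBl.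
Qed.

(** Elements [e i] that are 1 at [Ks i] and 0 at the others admit no collision: modulo [Ks j] only
    [sg (t j) - sg (u j)] survives, and it must then lie in [m]. So [q ^ M] is at most [L]. *)
Lemma cl_max_bound : exists L, forall M (Ks : 'I_M -> Q -> Prop),
  (forall i, cl_maxQ (Ks i)) ->
  (forall i j, (forall z, Ks i z <-> Ks j z) -> i = j) -> (M < L)%N.
Proof.
have [x [L [mx HL]]] := residue_collision.
exists L.+1 => M Ks HK dist; rewrite ltnS.
suff : (q ^ M <= L)%N by apply: leq_trans; apply/ltnW/ltn_expl/residue_card_gt1.
rewrite leqNgt; apply/negP => LM.
have [e He] := cl_max_crt HK dist.
have [c [y [nc Hy]]] := common_denominator e.
have [ci Hci] := inv_phi nc.
pose I a := exists2 b, B b & phi a = phi c * b.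
have [||||t [u [ntu [w [b Bb Hw] Hs]]]] := HL I M y _ _ _ _ LM.
- split; first by exists 0; [exact: closure0 | rewrite mulr0 rmorph0].
    move=> a a' [b Bb E] [b' Bb' E']; exists (b + b'); first exact: integral_add.
    by rewrite rmorphD E E' mulrDr.
  move=> r a [b Bb E]; exists (phi r * b); first by apply: integral_mul => //; exact: closure_phi.
  by rewrite rmorphM E mulrCA.
- by move=> a /ker_phi Ea; exists 0; [exact: closure0 | rewrite mulr0 Ea].
- by exists c => //; exists 1; [exact: closure1 | rewrite mulr1].
- by move=> i; exists (e i); [case: (He i) | rewrite Hy].
apply: ntu; apply/ffunP => j; apply: sg_inj.
have HKj := HK j; apply/(cl_max_local_iff _ HKj).
case: (HKj) => [HIj _ _]; have [KB K0 KD KM] := HIj.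
have E : \sum_i phi (sg (t i) - sg (u i)) * e i = phi x * b.
  rewrite -[LHS]mul1r -[RHS]mul1r -Hci.
  have -> : phi c * ci * (phi x * b) = ci * (phi x * phi w) by rewrite Hw; ring.
  rewrite -Hs rmorph_sum !mulr_sumr; apply: eq_bigr => i _.
  by rewrite rmorphM -Hy; ring.
have Kxb : Ks j (phi x * b) by rewrite mulrC; apply: KM => //; exact: cl_max_local.
rewrite (bigD1 j) //= in E.
have -> : phi (sg (t j) - sg (u j)) = phi (sg (t j) - sg (u j)) * (1 - e j)
   + (phi x * b - \sum_(i < M | i != j) phi (sg (t i) - sg (u i)) * e i).
  by rewrite -E; ring.
apply: (KD); first by apply: KM; [exact: closure_phi | case: (He j)].
apply: cl_idealB => //; apply: cl_ideal_sum => // i /eqP nij.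
by apply: KM; [exact: closure_phi | case: (He i) => _ _; apply => /esym].
Qed.

(** * Comparing two elements at a maximal ideal of the closure *)

(** Horner evaluation at [al]: the leading coefficient is [b], and [l] lists the others in
    decreasing degree. Keeping [b] in [Q] lets each partial value act as the leading coefficient of
    a shorter relation. *)
Definition horner_fold (al : Q) (b : Q) (l : seq A) := foldl (fun z c => z * al + phi c) b l.

Lemma horner_foldE al b l : horner_fold al b l =
  b * al ^+ size l + \sum_(i < size l) phi l`_i * al ^+ (size l - i.+1).
Proof.
elim: l b => [|c l IH] b /=; first by rewrite big_ord0 mulr1 addr0.
rewrite IH big_ord_recl /= subn1 /= exprS.
under [in RHS]eq_bigr do rewrite subSS.
by ring.
Qed.

(** Multiplying the relation by [b ^+ k.-1], with [k] its degree, gives a monic equation for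
    [b * al] with coefficients in [B]. *)
Lemma horner_fold_integral al b c l : B b -> horner_fold al b (c :: l) = 0 -> B (b * al).
Proof.
move=> Bb; rewrite horner_foldE; set k := size (c :: l); set s := c :: l => E.
pose p := \poly_(j < k) (phi s`_(k - j.+1) * b ^+ (k - j.+1)).
have szp : (size p < size ('X^k : {poly Q}))%N by rewrite size_polyXn ltnS size_poly.
apply: (@integral_root_monic _ _ _ _ ('X^k + p)).
- by rewrite monicE lead_coefDl // lead_coefXn.
- rewrite rootE hornerD hornerXn horner_poly; apply/eqP.
  apply: etrans (etrans (congr1 ( *%R (b ^+ k.-1)) E) (mulr0 _)); rewrite /= mulrDr exprMn.
  congr (_ + _); first by rewrite mulrA -exprSr.
  rewrite (reindex_inj rev_ord_inj) mulr_sumr; apply: eq_bigr => i _ /=.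
  rewrite subnSK // subKn ?(ltnW (ltn_ord i)) // exprMn.
  have -> : b ^+ k.-1 = b ^+ (i + (k - i.+1)) by rewrite -{1}(subnKC (ltn_ord i)).
  by rewrite exprD; ring.
- apply/integral_poly => i; rewrite coefD coefXn coef_poly; apply: integral_add.
    exact: integral_nat.
  case: ifP => _; last exact: closure0.
  by apply: integral_mul; [exact: closure_phi | exact: closureX].
Qed.

(** For each partial Horner value [u] followed by a coefficient, [u] and [u * al] are integral,
    hence in [K]; each coefficient is a partial value minus [al] times the preceding one. *)
Lemma horner_fold_coefs K al b l : cl_maxQ K -> B b -> horner_fold al b l = 0 ->
  (forall u, B u -> B (u * al) -> K u /\ K (u * al)) ->
  K b /\ forall c, c \in l -> K (phi c).
Proof.
move=> HK + + Hu; case: (HK) => [HI _ _]; have [KB K0 KD KM] := HI.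
elim: l b => [|c l IH] b Bb E; first by have -> : b = 0 := E.
have Bba := horner_fold_integral Bb E.
have [Kb Kba] := Hu b Bb Bba.
have [|Kb' Kl] := IH (b * al + phi c) _ E; first by apply: integral_add => //; exact: closure_phi.
split=> // c'; rewrite inE => /orP[/eqP ->|/Kl //].
by rewrite -[phi c](addKr (b * al)) addrC; apply: cl_idealB.
Qed.

(* The ideals [(g, h)^r] need a bounded number of generators, so for [r] large their [r+1] monomial
   generators satisfy a relation with a unit coefficient. *)
Lemma unit_relation g h al : nzd_red h -> phi h * al = phi g ->
  exists2 l, (exists2 c, c \in l & ~ m c) & horner_fold al 0 l = 0.
Proof.
move=> nh Eal; have [x [r [mx Hr]]] := residue_collision.
pose y (i : 'I_r.+1) := g ^+ (r - i) * h ^+ i.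
(* [I] is the ideal [(g, h)^r] enlarged by the nilpotent elements. *)
pose I a := exists w : 'I_r.+1 -> A, phi a = \sum_i phi (w i * y i).
have Lr : (r < q ^ r.+1)%N.
  apply: (leq_trans (ltn_expl _ residue_card_gt1)).
  by rewrite leq_exp2l ?residue_card_gt1.
have Iy i : I (y i).
  exists (fun j => (j == i)%:R); rewrite (bigD1 i) //= eqxx mul1r big1 ?addr0 // => j /negPf ->.
  by rewrite mul0r rmorph0.
have [|||t [u [ntu [w [d Hd] Hs]]]] := Hr I _ y _ _ _ Iy Lr.
- split.
  + by exists (fun=> 0); rewrite rmorph0 big1 // => i _; rewrite mul0r rmorph0.
  + move=> a b [v Ev] [w Ew]; exists (fun i => v i + w i); rewrite rmorphD Ev Ew -big_split.
    by apply: eq_bigr => i _; rewrite mulrDl rmorphD.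
  + move=> a b [v Ev]; exists (fun i => a * v i); rewrite rmorphM Ev mulr_sumr.
    by apply: eq_bigr => i _; rewrite -mulrA [in RHS]rmorphM.
- move=> a /ker_phi Ea; exists (fun=> 0).
  by rewrite Ea big1 // => i _; rewrite mul0r rmorph0.
- by exists (h ^+ r); [have := Iy ord_max; rewrite /y subnn mul1r | exact: nzd_redX].
(* Up to nilpotents [w] is the combination of the monomials with coefficients [d]. Since [x] is in
   [m], moving [x * w] to the left does not change the residues of the coefficients. *)
pose c (i : 'I_r.+1) := sg (t i) - sg (u i) - x * d i.
exists [seq c i | i <- enum 'I_r.+1].
  have [i ni] : exists i, t i <> u i.
    by apply: contrapT => H; apply: ntu; apply/ffunP => i; apply: contrapT => ?; apply: H; exists i.
  exists (c i); first by apply: map_f; rewrite mem_enum.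
  move=> mc; apply: ni; apply: sg_inj.
  have Hm := local_ideal localA.
  rewrite -[X in m X](subrK (x * d i)); case: (Hm) => _ mD _; apply: mD => //.
  exact: idealMr.
have [hi Hhi] := inv_phi (nzd_redX (n := r) nh).
rewrite horner_foldE mul0r add0r size_map size_enum_ord -[LHS]mul1r -Hhi.
rewrite [phi _ * hi]mulrC -mulrA mulr_sumr.
suff -> : \sum_(i < r.+1) phi (h ^+ r) * (phi [seq c j | j <- enum 'I_r.+1]`_i * al ^+ (r.+1 - i.+1))
   = phi (\sum_i (sg (t i) - sg (u i)) * y i) - phi x * phi w by rewrite Hs subrr mulr0.
rewrite Hd rmorph_sum mulr_sumr -sumrB; apply: eq_bigr => i _.
rewrite (nth_map i) ?size_enum_ord // nth_ord_enum subSS /c /y !(rmorphB, rmorphM, rmorphXn) -Eal.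
rewrite exprMn.
have -> : phi h ^+ r = phi h ^+ (r - i) * phi h ^+ i by rewrite -exprD subnK // -ltnS.
by ring.
Qed.

(** Put [al = g / h]. If the claim failed, [u] and [u * al] would be in [K] whenever both are in
    [B], and Horner's scheme would put every coefficient of the unit relation in [K], hence in
    [m]. *)
Lemma valuation_property K g h : cl_maxQ K -> nzd_red h ->
  exists u w, [/\ B u, B w, phi g * u = phi h * w & ~ K u \/ ~ K w].
Proof.
move=> HK nh; have [t Ht] := inv_phi nh.
pose al := phi g * t.
have Eal : phi h * al = phi g by rewrite /al mulrCA Ht mulr1.
have [l [c cl nc] El] := unit_relation nh Eal.
apply: contrapT => Hno; apply: nc; apply/(cl_max_local_iff _ HK).
have [_] : K 0 /\ forall c, c \in l -> K (phi c); last exact.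
apply: (horner_fold_coefs HK closure0 El) => u Bu Bua.
apply: contrapT => Hn; apply: Hno; exists u, (u * al); split=> //.
  by rewrite -Eal; ring.
by apply/not_andP.
Qed.

(** With denominators cleared: [g] is zero in the localization [B_K], and, in the next definition,
    [g] is a multiple of [d] there. *)
Definition vanishes_at (K : Q -> Prop) g := exists u, [/\ B u, ~ K u & phi g * u = 0].
Definition dominates_at (K : Q -> Prop) d g :=
  exists u w, [/\ B u, B w, ~ K u & phi g * u = phi d * w].

Lemma dominates_trans K a b c : cl_maxQ K ->
  dominates_at K a b -> dominates_at K b c -> dominates_at K a c.
Proof.
move=> HK [u [w [Bu Bw nu E]]] [u' [w' [Bu' Bw' nu' E']]].
exists (u * u'), (w * w'); split; [exact: integral_mul | exact: integral_mul | |].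
  exact: cl_max_notM.
have -> : phi c * (u * u') = phi c * u' * u by ring.
by rewrite E' mulrAC E mulrA.
Qed.

Lemma dominates_refl K a : cl_maxQ K -> dominates_at K a a.
Proof. by move=> [_ nK1 _]; exists 1, 1; split=> //; exact: closure1. Qed.

Lemma vanishes_dominated K a b : vanishes_at K b -> dominates_at K a b.
Proof. by move=> [u [Bu nu E]]; exists u, 0; split=> //; [exact: closure0 | rewrite mulr0]. Qed.

Lemma vanishes_dominates K a b : cl_maxQ K ->
  dominates_at K a b -> vanishes_at K a -> vanishes_at K b.
Proof.
move=> HK [u [w [Bu Bw nu E]]] [v [Bv nv Ev]]; exists (u * v); split.
- exact: integral_mul.
- exact: cl_max_notM.
- by rewrite mulrA E mulrAC Ev mul0r.
Qed.

(* With [z] a complement of [d], the idempotent [d / (d + z)] of the closure kills [z] and lies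
   outside [K], which reduces the claim to the comparison of [g] with the regular element [d + z]. *)
Lemma dominates_total K d g : cl_maxQ K -> ~ vanishes_at K d ->
  dominates_at K d g \/ dominates_at K g d.
Proof.
move=> HK nd; have [z [dz nz]] := nzd_red_complement noethA d.
have [t Ht] := inv_phi nz; move/ker_phi: dz; rewrite rmorphM => dz.
rewrite rmorphD in Ht.
(* [a * t] is idempotent, hence a root of [X^2 - X]. *)
have idem (a b : Q) : a * b = 0 -> (a + b) * t = 1 -> B (a * t) /\ a * t * (b * t) = 0.
  move=> ab abt; split; last by transitivity (a * b * t * t); [ring | rewrite ab !mul0r].
  apply: (@integral_root_monic _ _ _ _ ('X^2 - 'X)).
  - rewrite monicE lead_coefDl ?lead_coefXn // size_polyXn size_polyN size_polyX //.
  - rewrite rootE !hornerE; apply/eqP.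
    transitivity (a * t * ((a + b) * t) - a * b * t * t - a * t); first by ring.
    by rewrite abt ab; ring.
  - apply/integral_poly => i; rewrite coefB coefXn coefX; apply: integral_sub; exact: integral_nat.
have [Be Ee] := idem _ _ dz Ht.
have [Bf _] : B (phi z * t) /\ phi z * t * (phi d * t) = 0.
  by apply: idem; [rewrite mulrC | rewrite addrC].
pose e := phi d * t.
have ne : ~ K e.
  move=> Ke; apply: nd; exists (phi z * t); split=> //.
    move=> Kf; case: (HK) => [[_ _ KD _] nK1 _]; apply: nK1; rewrite -Ht mulrDl; exact: KD.
  by rewrite mulrA dz mul0r.
have ez : phi z * e = 0 by rewrite /e mulrA [phi z * _]mulrC dz mul0r.
have [u [w [Bu Bw E]]] := valuation_property g HK nz.
rewrite rmorphD mulrDl in E.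
(* Multiplication by [e] kills the [z] part of the regular element [d + z] and leaves [d]. *)
have E' : phi g * (u * e) = phi d * (w * e).
  by rewrite mulrA E mulrDl -!mulrA [w * e]mulrC [phi z * _]mulrA ez mul0r addr0.
have BMe v : B v -> B (v * e) by move=> Bv; apply: integral_mul.
case=> [nu|nw]; [left; exists (u * e), (w * e) | right; exists (w * e), (u * e)].
  by split=> //; [exact: BMe | exact: BMe | exact: cl_max_notM].
by split=> //; [exact: BMe | exact: BMe | exact: cl_max_notM].
Qed.

Lemma dominating_generator K (gs : seq A) : cl_maxQ K ->
  ~ (forall g, g \in gs -> vanishes_at K g) ->
  exists d, [/\ d \in gs, ~ vanishes_at K d & forall g, g \in gs -> dominates_at K d g].
Proof.
move=> HK; elim: gs => [|a gs IH] Hgs; first by case: Hgs.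
have [Hv|/IH[d [dgs nd Hd]]] := pselect (forall g, g \in gs -> vanishes_at K g).
  have na : ~ vanishes_at K a.
    by move=> va; apply: Hgs => g; rewrite inE => /orP[/eqP ->|/Hv].
  exists a; split=> //; first exact: mem_head.
  move=> g; rewrite inE => /orP[/eqP ->|/Hv /vanishes_dominated]; last exact.
  exact: dominates_refl.
have [da|ad] := dominates_total a HK nd.
  exists d; split=> //; first by rewrite inE dgs orbT.
  by move=> g; rewrite inE => /orP[/eqP ->|/Hd].
exists a; split; first exact: mem_head.
  by move=> /(vanishes_dominates HK ad).
move=> g; rewrite inE => /orP[/eqP ->|/Hd]; first exact: dominates_refl.
exact: dominates_trans.
Qed.

(** * Extension of ideals to the closure and the determinant trick *)

Definition extension (a : seq A) (z : Q) :=
  exists2 b : 'I_(size a) -> Q, (forall i, B (b i)) & z = \sum_(i < size a) phi a`_i * b i.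

Lemma extensionM a r z : B r -> extension a z -> extension a (r * z).
Proof.
move=> Br [b Bb ->]; exists (fun i => r * b i); first by move=> i; apply: integral_mul.
by rewrite mulr_sumr; apply: eq_bigr => i _; rewrite mulrCA.
Qed.

Lemma extensionD a y z : extension a y -> extension a z -> extension a (y + z).
Proof.
move=> [b Bb ->] [c Bc ->]; exists (fun i => b i + c i); first by move=> i; apply: integral_add.
by rewrite -big_split; apply: eq_bigr => i _; rewrite mulrDr.
Qed.

Lemma extension0 a : extension a 0.
Proof. by exists (fun=> 0); [move=> _; exact: closure0 | rewrite big1 // => i _; rewrite mulr0]. Qed.

Lemma extension_mem a x : x \in a -> extension a (phi x).
Proof.
move=> xa; have lt : (index x a < size a)%N by rewrite index_mem.
exists (fun i => (i == Ordinal lt)%:R); first by move=> i; exact: integral_nat.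
rewrite (bigD1 (Ordinal lt)) //= eqxx mulr1 nth_index // big1 ?addr0 // => i /negPf ->.
by rewrite mulr0.
Qed.

(** The [z] in [B] that multiply all of [gs] into [aB] form an ideal of [B]. If it were proper, a
    maximal ideal [K] would contain it, but the product of the local denominators at [K] is a
    multiplier outside [K]. *)
Lemma extension_local (a gs : seq A) :
  (forall K, cl_maxQ K -> (forall g, g \in gs -> vanishes_at K g) \/
     exists2 x, x \in a & forall g, g \in gs -> dominates_at K x g) ->
  forall g, g \in gs -> extension a (phi g).
Proof.
move=> H.
pose J z := B z /\ forall g, g \in gs -> extension a (z * phi g).
have HJ : cl_idealQ J.
  split.
  - by move=> z [].
  - by split; [exact: closure0 | move=> g _; rewrite mul0r; exact: extension0].
  - move=> y z [By Hy] [Bz Hz]; split; first exact: integral_add.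
    by move=> g gg; rewrite mulrDl; apply: extensionD; [exact: Hy | exact: Hz].
  - move=> r z Br [Bz Hz]; split; first exact: integral_mul.
    by move=> g /Hz /(extensionM Br); rewrite mulrA.
have [[_ H1] g /H1|nJ1] := pselect (J 1); first by rewrite mul1r.
have [K HK JK] := cl_max_exists HJ nJ1.
have loc g : g \in gs -> exists u, [/\ B u, ~ K u & extension a (u * phi g)].
  move=> ggs; case: (H K HK) => [/(_ g ggs)[u [Bu nu E]]|[x xa /(_ g ggs)[u [w [Bu Bw nu E]]]]].
    by exists u; split=> //; rewrite mulrC E; exact: extension0.
  exists u; split=> //; rewrite mulrC E mulrC; apply: extensionM => //.
  exact: extension_mem.
have [u [Bu nu Hu]] : exists u, [/\ B u, ~ K u & forall g, g \in gs -> extension a (u * phi g)].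
  elim: gs loc {H J HJ nJ1 JK} => [|g gs IH] loc.
    by exists 1; split=> //; [exact: closure1 | case: HK].
  have [u [Bu nu Eu]] := loc g (mem_head _ _).
  have [|v [Bv nv Ev]] := IH; first by move=> h hgs; apply: loc; rewrite inE hgs orbT.
  exists (u * v); split; [exact: integral_mul | exact: cl_max_notM |] => h.
  rewrite inE => /orP[/eqP ->|/Ev H]; first by rewrite [u * v]mulrC -mulrA; apply: extensionM.
  by rewrite -mulrA; apply: extensionM.
by case: nu; apply: JK.
Qed.

Definition phi_span (v : seq Q) z := exists c : nat -> A, z = \sum_(i < size v) phi (c i) * v`_i.

Lemma phi_spanD v y z : phi_span v y -> phi_span v z -> phi_span v (y + z).
Proof.
move=> [c ->] [d ->]; exists (fun i => c i + d i); rewrite -big_split.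
by apply: eq_bigr => i _; rewrite rmorphD mulrDl.
Qed.

Lemma phi_spanM v a z : phi_span v z -> phi_span v (phi a * z).
Proof.
move=> [c ->]; exists (fun i => a * c i); rewrite mulr_sumr.
by apply: eq_bigr => i _; rewrite rmorphM mulrA.
Qed.

Lemma phi_span_sum v (T : Type) (r : seq T) (P : pred T) (F : T -> Q) :
  (forall i, P i -> phi_span v (F i)) -> phi_span v (\sum_(i <- r | P i) F i).
Proof.
move=> HF; apply: big_ind => //; last exact: phi_spanD.
by exists (fun=> 0); rewrite big1 // => i _; rewrite rmorph0 mul0r.
Qed.

Lemma phi_span_mem v x : x \in v -> phi_span v x.
Proof.
move=> xv; have lt : (index x v < size v)%N by rewrite index_mem.
exists (fun i => (i == index x v)%:R).
rewrite (bigD1 (Ordinal lt)) //= eqxx rmorph1 mul1r nth_index // big1 ?addr0 // => i.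
by rewrite -val_eqE /= => /negPf ->; rewrite rmorph0 mul0r.
Qed.

(** Integral elements are adjoined one at a time: with an equation of degree [d] for [b], the powers
    of [b] below [d] times the earlier generators suffice. *)
Lemma finite_module (bs : seq Q) : (forall b, b \in bs -> B b) ->
  exists v, 1 \in v /\ forall b x, b \in bs -> x \in v -> phi_span v (b * x).
Proof.
elim: bs => [|b bs IH] Bbs; first by exists [:: 1]; split=> //; exact: mem_head.
have [|v [v1 Hv]] := IH; first by move=> c cbs; apply: Bbs; rewrite inE cbs orbT.
have [p mon_p /eqP pb] := Bbs b (mem_head _ _).
pose d := (size p).-1.
have szp : size p = d.+1 by rewrite prednK // lt0n size_poly_eq0 monic_neq0.
have pd : p`_d = 1 by move: mon_p; rewrite monicE lead_coefE => /eqP.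
have {pb} pb : b ^+ d = \sum_(j < d) phi (- p`_j) * b ^+ j.
  move: pb; rewrite (@horner_coef_wide _ d.+1) ?size_map_poly_id0 ?szp //; last first.
    by rewrite (monicP mon_p) rmorph1 oner_eq0.
  rewrite big_ord_recr /= coef_map /= pd rmorph1 mul1r => /eqP; rewrite addrC addr_eq0 => /eqP ->.
  by rewrite -sumrN; apply: eq_bigr => i _; rewrite coef_map rmorphN mulNr.
have d0 : (0 < d)%N.
  by case: d pb {szp pd} => // /eqP; rewrite big_ord0 expr0 oner_eq0.
pose v' := [seq b ^+ i * x | i <- iota 0 d, x <- v].
have v'mem i x : (i < d)%N -> x \in v -> b ^+ i * x \in v'.
  by move=> id xv; apply: allpairs_f => //; rewrite mem_iota.
exists v'; split; first by have := v'mem 0%N 1 d0 v1; rewrite mulr1.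
move=> c _ cbs /allpairsP[[i x] /= [+ xv ->]]; rewrite mem_iota add0n /= => id.
move: cbs; rewrite inE => /orP[/eqP ->|cbs].
  rewrite mulrA -exprS; move: id; rewrite leq_eqVlt => /orP[/eqP ->|id].
    rewrite pb mulr_suml; apply: phi_span_sum => j _; rewrite -mulrA.
    exact/phi_spanM/phi_span_mem/v'mem.
  exact/phi_span_mem/v'mem.
rewrite mulrCA; have [e ->] := Hv c x cbs xv; rewrite mulr_sumr.
apply: phi_span_sum => j _; rewrite mulrCA; apply/phi_spanM/phi_span_mem/v'mem => //.
exact: mem_nth.
Qed.

(** [g - M] kills the vector [v], so by the adjugate its determinant kills every entry of [v], in
    particular the entry 1. *)
Lemma det_nilp g (v : seq Q) (M : 'M[A]_(size v)) : 1 \in v ->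
  (forall i : 'I_(size v), phi g * v`_i = \sum_j phi (M i j) * v`_(nat_of_ord j)) ->
  nilp (\det (g%:M - M)).
Proof.
move=> v1 Hg; apply/ker_phi; rewrite -det_map_mx.
set X := map_mx _ _; pose w : 'cV_(size v) := \col_i v`_i.
have Xw : X *m w = 0.
  rewrite /X map_mxB map_scalar_mx mulmxBl mul_scalar_mx; apply/colP => i.
  by rewrite !mxE Hg -sumrB big1 // => j _; rewrite !mxE subrr.
have lt : (index 1%R v < size v)%N by rewrite index_mem.
have := congr1 (mulmx (\adj X)) Xw; rewrite mulmxA mul_adj_mx mulmx0 mul_scalar_mx.
by move/colP/(_ (Ordinal lt)); rewrite !mxE /= nth_index // mulr1.
Qed.

(* The determinant trick, with all determinants expanded in powers of [I]. *)
Lemma extension_power I a g : is_ideal I -> (forall x, x \in a -> I x) -> I g ->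
  extension a (phi g) ->
  exists e, ideal_mul (ideal_gen a) (ideal_pow I e) (g ^+ e.+1).
Proof.
move=> HI aI Ig [b Bb Eg].
have [|v [v1 Hv]] := @finite_module [seq b i | i <- enum 'I_(size a)].
  by move=> _ /mapP[i _ ->].
have Hc i j : exists c : nat -> A, (j < size v)%N ->
    b i * v`_j = \sum_(l < size v) phi (c l) * v`_l.
  case: (ltnP j (size v)) => jv; last by exists (fun=> 0).
  have [|c Ec] := Hv (b i) v`_j _ (mem_nth _ jv); last by exists c.
  by apply: map_f; rewrite mem_enum.
pose c i j := sval (cid (Hc i j)).
have cP i j : (j < size v)%N -> b i * v`_j = \sum_(l < size v) phi (c i j l) * v`_l.
  by rewrite /c; case: cid.
set J := ideal_gen a.
have HJ : is_ideal J by exact: is_ideal_gen.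
have JI : subset J I by apply: ideal_gen_min.
(* Since [phi g] is a combination of [a] with coefficients [b], it acts on the generators [v]
   through a matrix with entries in [J]. *)
pose M : 'M[A]_(size v) := \matrix_(j, l) \sum_(i < size a) a`_i * c i j l.
have JM i j : J (M i j).
  rewrite mxE; apply: ideal_sum => // k _; apply: idealMr => //.
  exact/ideal_gen_mem/mem_nth.
have nM : nilp (\det (g%:M - M)).
  apply: det_nilp => // j; rewrite Eg mulr_suml.
  under eq_bigr do rewrite -mulrA cP // mulr_sumr.
  rewrite exchange_big; apply: eq_bigr => l _; rewrite mxE rmorph_sum mulr_suml.
  by apply: eq_bigr => i _; rewrite rmorphM mulrA.
have Ig' i j : I ((g%:M : 'M[A]_(size v)) i j).
  by rewrite mxE; case: eqP => _ //; case: HI.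
set k := (size v).-1.
have kv : size v = k.+1 by rewrite prednK //; case: (v) v1.
have := @det_congr_pow _ I J _ (g%:M - M) g%:M HI HJ _ Ig' _.
rewrite det_scalar -/k => HD; set D := \det _ in nM HD.
have {}HD : ideal_mul J (ideal_pow I k) (D - g ^+ size v).
  have E i j : (g%:M - M) i j = (g%:M : 'M_(size v)) i j - M i j.
    by rewrite mxE [(- M) i j]mxE.
  apply: HD => i j; rewrite E; first by apply: idealB => //; exact/JI/JM.
  by rewrite addrAC subrr sub0r; apply: idealN.
rewrite kv in HD.
have HP n := is_ideal_mul (ideal_pow I n) HJ.
have Ik : ideal_pow I k.+1 (g ^+ k.+1) by exact: ideal_powX.
have ID : ideal_pow I k.+1 D.
  rewrite -[D](subrK (g ^+ k.+1)); case: (is_ideal_pow k.+1 HI) => _ PD _.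
  by apply: PD => //; apply: ideal_mul_pow_sub HD.
(* [D] is only nilpotent, so it is compared with [g ^+ k.+1] after raising both to the power [e.+1]:
   the difference is a multiple of [D - g ^+ k.+1] by an element of the power [k.+1 * e] of [I]. *)
case: nM => e De; exists (k + k.+1 * e)%N.
have -> : g ^+ (k + k.+1 * e).+1 = - (D ^+ e.+1 - (g ^+ k.+1) ^+ e.+1).
  by rewrite [D ^+ _]exprS De mulr0 sub0r opprK -exprM mulnS addSn.
apply: idealN => //; rewrite subrXX; apply: ideal_mul_powM => //.
have HPI := is_ideal_pow (k.+1 * e) HI.
apply: ideal_sum => // i _ /=.
have -> : (k.+1 * e = k.+1 * (e - i) + k.+1 * i)%N by rewrite -mulnDr subnK // -ltnS.
by apply: ideal_powM => //; apply: ideal_powXk.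
Qed.

(** * The submodules to avoid and the two bounds on [n] *)

(** The elements whose image lies in [d K B_K]; on an ideal dominated by [d] they form the submodule
    to avoid at [K]. *)
Definition small_at (K : Q -> Prop) d x :=
  exists u w, [/\ B u, ~ K u, K w & phi x * u = phi d * w].

Lemma is_ideal_small K d : cl_maxQ K -> is_ideal (small_at K d).
Proof.
move=> HK; have [[KB K0 KD KM] nK1 _] := HK; split.
- by exists 1, 0; split=> //; [exact: closure1 | rewrite rmorph0 mul0r mulr0].
- move=> x y [u [w [Bu nu Kw E]]] [u' [w' [Bu' nu' Kw' E']]].
  exists (u * u'), (u' * w + u * w'); split.
  + exact: integral_mul.
  + exact: cl_max_notM.
  + by apply: KD; exact: KM.
  + rewrite rmorphD mulrDl mulrA E mulrCA E'; ring.
- move=> r x [u [w [Bu nu Kw E]]]; exists u, (phi r * w); split=> //.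
    by apply: KM => //; exact: closure_phi.
  by rewrite rmorphM -mulrA E; ring.
Qed.

Lemma is_ideal_dominated K d : cl_maxQ K -> is_ideal (dominates_at K d).
Proof.
move=> HK; split.
- by apply: vanishes_dominated; exists 1; split; [exact: closure1 | case: HK | rewrite rmorph0 mul0r].
- move=> x y [u [w [Bu Bw nu E]]] [u' [w' [Bu' Bw' nu' E']]].
  exists (u * u'), (u' * w + u * w'); split.
  + exact: integral_mul.
  + by apply: integral_add; exact: integral_mul.
  + exact: cl_max_notM.
  + rewrite rmorphD mulrDl mulrA E mulrCA E'; ring.
- move=> r x [u [w [Bu Bw nu E]]]; exists u, (phi r * w); split=> //.
    by apply: integral_mul => //; exact: closure_phi.
  by rewrite rmorphM -mulrA E; ring.
Qed.

Lemma small_local K d a g : cl_maxQ K -> m a -> dominates_at K d g -> small_at K d (a * g).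
Proof.
move=> HK ma [u [w [Bu Bw nu E]]]; exists u, (w * phi a); split=> //.
  by have [[KB K0 KD KM] _ _] := HK; apply: KM => //; exact: cl_max_local.
by rewrite rmorphM -mulrA E; ring.
Qed.

Lemma not_small K d : cl_maxQ K -> ~ vanishes_at K d -> ~ small_at K d d.
Proof.
move=> HK nd [u [w [Bu nu Kw E]]]; apply: nd; exists (u - w).
have [HI _ _] := HK; have [KB K0 KD KM] := HI; split.
- by apply: integral_sub => //; exact: KB.
- by move=> H; apply: nu; rewrite -[u](subrK w); apply: KD.
- by rewrite mulrBr E subrr.
Qed.

Lemma dominates_of_not_small K d x : cl_maxQ K -> dominates_at K d x ->
  ~ small_at K d x -> dominates_at K x d.
Proof.
move=> HK [u [w [Bu Bw nu E]]] nx; exists w, u; split=> // Kw.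
by apply: nx; exists u, w.
Qed.

Lemma exists_small_reduction N (Ks : 'I_N -> Q -> Prop) n (I : A -> Prop) :
  (forall i, cl_maxQ (Ks i)) -> (forall K, cl_maxQ K -> exists i, K = Ks i) ->
  (N < geom q n.+1)%N -> is_ideal I -> has_n_gen_reduction I n.
Proof.
move=> HK covK NG HI; have [gs Igs] := noethA HI.
pose S := [set i | ~~ `[< forall g, g \in gs -> vanishes_at (Ks i) g >]].
have Hd i : exists d, i \in S -> [/\ d \in gs, ~ vanishes_at (Ks i) d &
    forall g, g \in gs -> dominates_at (Ks i) d g].
  case: (boolP (i \in S)); last by exists 0.
  by rewrite inE => /asboolPn /(dominating_generator (HK i))[d Hd]; exists d.
pose d i := sval (cid (Hd i)).
have dP i : i \in S -> [/\ d i \in gs, ~ vanishes_at (Ks i) (d i) &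
    forall g, g \in gs -> dominates_at (Ks i) (d i) g] by rewrite /d; case: cid.
have [||||a [sa aI Ha]] := @exists_avoiding_family _ _ noethA localA q sg sg_inj sg_cov gs N
    (fun i => small_at (Ks i) (d i)) n S.
- by move=> i _; exact: is_ideal_small.
- by move=> i x g /dP[_ _ dg] mx /dg; exact: small_local.
- by move=> i /dP[dgs nd _]; exists (d i) => //; exact: not_small.
- by apply: leq_ltn_trans NG; rewrite -[X in (_ <= X)%N](card_ord N) max_card.
exists a; split=> //.
have aI' x : x \in a -> I x by move=> /aI /Igs.
apply: (@reduction_of_generators _ _ _ gs) => //; first exact: is_ideal_gen.
  exact: ideal_gen_min.
move=> g ggs; apply: extension_power => //; first exact/Igs/ideal_gen_mem.
apply: (@extension_local a gs) => // _ /covK[i ->].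
have [Hv|nv] := pselect (forall h, h \in gs -> vanishes_at (Ks i) h); first by left.
have iS : i \in S by rewrite inE; apply/asboolPn.
(* An element of [a] outside the submodule differs from [d i] locally by a unit, so it too divides
   every generator. *)
have [x xa nx] := Ha i iS; have [dgs _ dg] := dP i iS.
right; exists x => // h /dg; apply: dominates_trans => //.
apply: dominates_of_not_small => //.
exact: (ideal_gen_min (is_ideal_dominated _ (HK i)) dg (aI x xa)).
Qed.

Lemma exists_ideal_without_reduction N (Ks : 'I_N -> Q -> Prop) n :
  (forall i, cl_maxQ (Ks i)) ->
  (forall i j, (forall z, Ks i z <-> Ks j z) -> i = j) ->
  (geom q n.+1 <= N)%N ->
  exists2 I : A -> Prop, is_ideal I & ~ has_n_gen_reduction I n.
Proof.
move=> HK dist GN.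
pose pts := projective_points sg n.+1.
have szp : size pts = geom q n.+1 by exact: size_projective_points.
have [ep Hep] := cl_max_crt HK dist.
(* Modulo [Ks i] the element [e j] is the [j]-th coordinate of the [i]-th projective point; beyond
   the list of points the default [[::]] gives residue 0. *)
pose e (j : 'I_n.+1) := \sum_(i < N) phi (nth [::] pts i)`_j * ep i.
have Be j : B (e j).
  by apply: closure_sum => i _; apply: integral_mul; [exact: closure_phi | case: (Hep i)].
have He i (j : 'I_n.+1) : Ks i (e j - phi (nth [::] pts i)`_j).
  have [[KB K0 KD KM] _ _] := HK i; have HI : cl_idealQ (Ks i) by case: (HK i).
  rewrite /e (bigD1 i) //=; set s := \sum_(_ < _ | _) _; set p := phi _.
  have -> : p * ep i + s - p = s - p * (1 - ep i) by ring.
  apply: cl_idealB => //; last by apply: KM; [exact: closure_phi | case: (Hep i)].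
  apply: cl_ideal_sum => // l /eqP nl; apply: KM; first exact: closure_phi.
  by case: (Hep l) => _ _; apply => /esym.
have [c [y [nc Hy]]] := common_denominator e.
pose gs := [seq y j | j <- enum 'I_n.+1].
have szg : size gs = n.+1 by rewrite size_map size_enum_ord.
have gsE (j : 'I_n.+1) : gs`_j = y j by rewrite (nth_map j) ?size_enum_ord // nth_ord_enum.
exists (ideal_gen gs); first exact: is_ideal_gen.
move=> [a [sa [_ aI [r [_ Hr]]]]].
have Hc l : exists C : nat -> A, (l < n)%N -> a`_l = \sum_(j < n.+1) C j * y j.
  case: (ltnP l n) => ln; last by exists (fun=> 0).
  have /ideal_genP[C EC] : ideal_gen gs a`_l by apply/aI/ideal_gen_mem/mem_nth; rewrite sa.
  exists C => _; rewrite EC szg; apply: eq_bigr => j _; by rewrite gsE.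
pose C l := sval (cid (Hc l)).
have HC l : (l < n)%N -> a`_l = \sum_(j < n.+1) C l j * y j by rewrite /C; case: cid.
(* The generators of the reduction are [n] linear forms in the [y j]. A common zero [p] modulo [m],
   normalised to a point [w] of the list, singles out a maximal ideal [Ks i] that contains all of
   them after division by [c]. *)
have [p pn Hp] := residue_kernel_vector localA sg_inj sg_cov n C.
have [u [w [wp Hw]]] := projective_pointsP noethA localA sg_cov pn.
have wN : (index w pts < N)%N by apply: leq_trans GN; rewrite -szp index_mem.
pose i := Ordinal wN.
have Ei j : (nth [::] pts i)`_j = w`_j by rewrite nth_index.
have [[KB K0 KD KM] nK1 _] := HK i; have HI : cl_idealQ (Ks i) by case: (HK i).
have Hm := local_ideal localA; have [m0 mD mM] := Hm.
have Ka l : (l < n)%N -> exists2 b, Ks i b & phi a`_l = phi c * b.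
  move=> ln; exists (\sum_(j < n.+1) phi (C l j) * e j); last first.
    rewrite HC // rmorph_sum mulr_sumr; apply: eq_bigr => j _.
    by rewrite rmorphM -Hy; ring.
  have -> : \sum_(j < n.+1) phi (C l j) * e j =
     \sum_(j < n.+1) phi (C l j) * (e j - phi w`_j) + phi (\sum_(j < n.+1) C l j * w`_j).
    rewrite rmorph_sum -big_split; apply: eq_bigr => j _; rewrite rmorphM /=; ring.
  apply: (KD); first by apply: cl_ideal_sum => // j _; rewrite -Ei; apply: KM => //; exact: closure_phi.
  apply: cl_max_local => //.
  have -> : \sum_(j < n.+1) C l j * w`_j =
     u * (\sum_(j < n.+1) C l j * p j) - \sum_(j < n.+1) C l j * (u * p j - w`_j).
    by rewrite mulr_sumr -sumrB; apply: eq_bigr => j _; ring.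
  apply: idealB => //; first by apply: mM; exact: Hp.
  by apply: ideal_sum => // j _; apply: mM; exact: Hw.
have IB : subset (ideal_gen gs) (fun x => exists2 b, B b & phi x = phi c * b).
  apply: ideal_gen_min; last first.
    by move=> _ /mapP[j _ ->]; exists (e j) => //; rewrite Hy.
  split.
  - by exists 0; [exact: closure0 | rewrite rmorph0 mulr0].
  - move=> x z [b Bb E] [b' Bb' E']; exists (b + b'); first exact: integral_add.
    by rewrite rmorphD E E' mulrDr.
  - move=> s x [b Bb E]; exists (phi s * b); first by apply: integral_mul => //; exact: closure_phi.
    by rewrite rmorphM E mulrCA.
have IBk k : subset (ideal_pow (ideal_gen gs) k)
    (fun x => exists2 b, B b & phi x = phi c ^+ k * b).
  elim: k => [|k IH]; first by move=> x _; exists (phi x); [exact: closure_phi | rewrite mul1r].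
  apply: ideal_mul_min.
  - by exists 0; [exact: closure0 | rewrite rmorph0 mulr0].
  - move=> x z [b Bb E] [b' Bb' E']; exists (b + b'); first exact: integral_add.
    by rewrite rmorphD E E' mulrDr.
  - move=> x z /IB[b Bb E] /IH[b' Bb' E']; exists (b * b'); first exact: integral_mul.
    by rewrite rmorphM E E' exprS; ring.
have [j jn wj] := projective_points_unit wp.
pose o := Ordinal jn.
have neo : ~ Ks i (e o).
  move=> Ko; apply: nK1; have := He i o; rewrite Ei /= wj rmorph1 => H1.
  by rewrite -[1](subKr (e o)); apply: cl_idealB.
have [ci Hci] := inv_phi nc.
have : ideal_mul (ideal_gen a) (ideal_pow (ideal_gen gs) r) (y o ^+ r.+1).
  apply/Hr; apply: (@ideal_powX _ _ _ r.+1); apply: ideal_gen_mem.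
  by apply: map_f; rewrite mem_enum.
(* The product of the reduction with the [r]-th power lies in [c^(r+1) Ks i], whereas [y o ^+ r.+1]
   is [c^(r+1)] times a power of [e o], which is outside [Ks i]. *)
suff sub : subset (ideal_mul (ideal_gen a) (ideal_pow (ideal_gen gs) r))
    (fun x => exists2 b, Ks i b & phi x = phi c ^+ r.+1 * b).
  move=> /sub[b Kb]; rewrite rmorphXn -Hy exprMn => E.
  apply: (@cl_max_notX _ (e o) r.+1 (HK i) (Be o) neo).
  have -> : e o ^+ r.+1 = ci ^+ r.+1 * (phi c ^+ r.+1 * e o ^+ r.+1).
    by rewrite mulrA -exprMn [ci * _]mulrC Hci expr1n mul1r.
  by rewrite E mulrA -exprMn [ci * _]mulrC Hci expr1n mul1r.
apply: ideal_mul_min.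
- by exists 0 => //; rewrite rmorph0 mulr0.
- by move=> x z [b Bb E] [b' Bb' E']; exists (b + b'); [exact: KD | rewrite rmorphD E E' mulrDr].
- move=> x z Hx /IBk[b' Bb' E'].
  have [b Kb E] : exists2 b, Ks i b & phi x = phi c * b.
    have [d ->] : exists d : nat -> A, x = \sum_(l < size a) d l * a`_l by apply/ideal_genP.
    pose f l := if pselect (l < n)%N is left h then sval (cid2 (Ka l h)) else 0.
    have fP l : (l < n)%N -> Ks i (f l) /\ phi a`_l = phi c * f l.
      by move=> ln; rewrite /f; case: pselect => // h; case: cid2.
    exists (\sum_(l < size a) phi (d l) * f l).
      apply: cl_ideal_sum => // l _; apply: KM; first exact: closure_phi.
      by case: (fP l); rewrite // -sa.
    rewrite rmorph_sum mulr_sumr; apply: eq_bigr => l _.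
    have [|_ El] := fP l; first by rewrite -sa.
    by rewrite rmorphM El; ring.
  exists (b' * b); first exact: KM.
  by rewrite rmorphM E E' exprS; ring.
Qed.

End FiniteResidueField.
End TotalQuotientRing.

(** * The total quotient ring *)

Module TotalQuotient.
Section TotalQuotient.
Local Open Scope quotient_scope.
Variable A : comNzRingType.

(** The boolean form of regularity makes these fractions a subtype of [A * A], from which they
    inherit the choice structure that the quotient needs. *)
Record rfrac := RFrac { rfrac_val :> A * A; _ : `[< nzd_red rfrac_val.2 >] }.

HB.instance Definition _ := [isSub for rfrac_val].
HB.instance Definition _ := [Choice of rfrac by <:].

Lemma rfracP (x : rfrac) : nzd_red x.2.
Proof. by case: x => x /= /asboolP. Qed.
Arguments rfracP : clear implicits.

Definition mkf a s (h : nzd_red s) : rfrac := @RFrac (a, s) (asboolT h).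

Definition requiv (x y : rfrac) := `[< frac_eq x y >].

Lemma requiv_refl : reflexive requiv.
Proof. by move=> x; apply/asboolP; rewrite /frac_eq subrr; exact: nilp0. Qed.

Lemma requiv_sym : symmetric requiv.
Proof.
have sym x y : frac_eq (A := A) x y -> frac_eq y x.
  by move=> H; rewrite /frac_eq -opprB; exact: idealN (is_ideal_nilp A) H.
by move=> x y; apply/asboolP/asboolP; exact: sym.
Qed.

Lemma requiv_trans : transitive requiv.
Proof.
move=> y x z /asboolP xy /asboolP yz; apply/asboolP; rewrite /frac_eq.
apply: (rfracP y).
have -> : y.2 * (x.1 * z.2 - z.1 * x.2) =
   (x.1 * y.2 - y.1 * x.2) * z.2 + (y.1 * z.2 - z.1 * y.2) * x.2 by ring.
by apply: nilpD; exact: nilpMr.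
Qed.

Canonical requiv_equiv := EquivRel requiv requiv_refl requiv_sym requiv_trans.

Definition type := {eq_quot requiv}.
HB.instance Definition _ : EqQuotient _ requiv type := EqQuotient.on type.
HB.instance Definition _ := Choice.on type.

Definition class (x : rfrac) : type := \pi_type x.

Lemma class_eq x y : class x = class y <-> frac_eq x y.
Proof. by split=> [/eqmodP/asboolP|h]; last exact/eqmodP/asboolP. Qed.

Lemma class_repr u : class (repr u) = u.
Proof. exact: reprK. Qed.

Lemma repr_class x : frac_eq (repr (class x)) x.
Proof. by apply/class_eq; rewrite class_repr. Qed.

Definition addf (x y : rfrac) : rfrac :=
  mkf (x.1 * y.2 + y.1 * x.2) (nzd_redM (rfracP x) (rfracP y)).
Definition mulf (x y : rfrac) : rfrac :=
  mkf (x.1 * y.1) (nzd_redM (rfracP x) (rfracP y)).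
Definition oppf (x : rfrac) : rfrac := mkf (- x.1) (rfracP x).
Lemma nzd_red1 : nzd_red (1 : A). Proof. by move=> x; rewrite mul1r. Qed.
Definition inj a : rfrac := mkf a nzd_red1.

Definition add (u v : type) := class (addf (repr u) (repr v)).
Definition mul (u v : type) := class (mulf (repr u) (repr v)).
Definition opp (u : type) := class (oppf (repr u)).

Lemma addE x y : add (class x) (class y) = class (addf x y).
Proof.
apply/class_eq; rewrite /frac_eq /=.
have := repr_class x; have := repr_class y; rewrite /frac_eq.
move: (repr (class x)) (repr (class y)) => x' y' Hy Hx.
set l := (X in nilp X).
have -> : l = (x'.1 * x.2 - x.1 * x'.2) * (y.2 * y'.2) + (y'.1 * y.2 - y.1 * y'.2) * (x.2 * x'.2).
  by rewrite /l; ring.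
by apply: nilpD; exact: nilpMr.
Qed.

Lemma mulE x y : mul (class x) (class y) = class (mulf x y).
Proof.
apply/class_eq; rewrite /frac_eq /=.
have := repr_class x; have := repr_class y; rewrite /frac_eq.
move: (repr (class x)) (repr (class y)) => x' y' Hy Hx.
set l := (X in nilp X).
have -> : l = (x'.1 * x.2 - x.1 * x'.2) * (y'.1 * y.2) + (y'.1 * y.2 - y.1 * y'.2) * (x.1 * x'.2).
  by rewrite /l; ring.
by apply: nilpD; exact: nilpMr.
Qed.

Lemma oppE x : opp (class x) = class (oppf x).
Proof.
apply/class_eq; rewrite /frac_eq /=; have := repr_class x; rewrite /frac_eq.
move: (repr _) => x' Hx.
have -> : - x'.1 * x.2 - - x.1 * x'.2 = - (x'.1 * x.2 - x.1 * x'.2) by ring.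
by apply: idealN => //; exact: is_ideal_nilp.
Qed.

Lemma class_ind (P : type -> Prop) : (forall x, P (class x)) -> forall u, P u.
Proof. by move=> H u; rewrite -[u]class_repr. Qed.

Lemma frac_eq0 (x y : rfrac) : x.1 * y.2 = y.1 * x.2 -> class x = class y.
Proof. by move=> E; apply/class_eq; rewrite /frac_eq E subrr; exact: nilp0. Qed.

Lemma addA : associative add.
Proof.
elim/class_ind=> x; elim/class_ind=> y; elim/class_ind=> z; rewrite !addE.
by apply: frac_eq0 => /=; ring.
Qed.
Lemma addC : commutative add.
Proof. by elim/class_ind=> x; elim/class_ind=> y; rewrite !addE; apply: frac_eq0 => /=; ring. Qed.
Lemma add0 : left_id (class (inj 0)) add.
Proof. by elim/class_ind=> x; rewrite !addE; apply: frac_eq0 => /=; ring. Qed.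
Lemma addN : left_inverse (class (inj 0)) opp add.
Proof. by elim/class_ind=> x; rewrite oppE !addE; apply: frac_eq0 => /=; ring. Qed.

HB.instance Definition _ := GRing.isZmodule.Build type addA addC add0 addN.

Lemma mulA : associative mul.
Proof.
elim/class_ind=> x; elim/class_ind=> y; elim/class_ind=> z; rewrite !mulE.
by apply: frac_eq0 => /=; ring.
Qed.
Lemma mulC : commutative mul.
Proof. by elim/class_ind=> x; elim/class_ind=> y; rewrite !mulE; apply: frac_eq0 => /=; ring. Qed.
Lemma mul1 : left_id (class (inj 1)) mul.
Proof. by elim/class_ind=> x; rewrite !mulE; apply: frac_eq0 => /=; ring. Qed.
Lemma mulD : left_distributive mul add.
Proof.
elim/class_ind=> x; elim/class_ind=> y; elim/class_ind=> z; rewrite !(addE, mulE).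
by apply: frac_eq0 => /=; ring.
Qed.
Lemma nonzero1 : class (inj 1) != class (inj 0).
Proof.
apply/eqP => /class_eq; rewrite /frac_eq /= mul0r subr0 mulr1 => -[n].
by rewrite expr1n => /eqP; rewrite oner_eq0.
Qed.

HB.instance Definition _ :=
  GRing.Zmodule_isComNzRing.Build type mulA mulC mul1 mulD nonzero1.

Definition embed a : type := class (inj a).

Lemma embed_zmod : zmod_morphism embed.
Proof.
move=> a b; rewrite /embed.
rewrite [RHS](_ : _ = add (class (inj a)) (opp (class (inj b)))) // oppE addE.
by apply: frac_eq0 => /=; ring.
Qed.
Lemma embed_monoid : monoid_morphism embed.
Proof.
split=> // a b; rewrite [RHS](_ : _ = mul (class (inj a)) (class (inj b))) // mulE.
by apply: frac_eq0 => /=; ring.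
Qed.
HB.instance Definition _ := GRing.isZmodMorphism.Build A type embed embed_zmod.
HB.instance Definition _ := GRing.isMonoidMorphism.Build A type embed embed_monoid.

Lemma embed_eq0 a : embed a = 0 <-> nilp a.
Proof.
have -> : (embed a = 0) = (class (inj a) = class (inj 0)) by [].
by rewrite class_eq /frac_eq /= mul0r subr0 mulr1.
Qed.

Lemma embed_inv s : nzd_red s -> exists t, embed s * t = 1.
Proof.
move=> hs; exists (class (mkf 1 hs)).
rewrite [LHS](_ : _ = mul (class (inj s)) (class (mkf 1 hs))) // mulE.
by apply: frac_eq0 => /=; ring.
Qed.

Lemma embed_frac z : exists s a, nzd_red s /\ embed s * z = embed a.
Proof.
elim/class_ind: z => x; exists x.2, x.1; split; first exact: rfracP.
rewrite [LHS](_ : _ = mul (class (inj x.2)) (class x)) // mulE.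
by apply: frac_eq0 => /=; ring.
Qed.

End TotalQuotient.
End TotalQuotient.
HB.export TotalQuotient.

(** * Fractions as names for elements of the total quotient ring *)

Section Translation.
Variables (A Q : comNzRingType) (phi : {rmorphism A -> Q}).
Hypothesis ker_phi : forall a, phi a = 0 <-> nilp a.
Hypothesis inv_phi : forall s, nzd_red s -> exists t, phi s * t = 1.
Hypothesis frac_phi : forall z, exists s a, nzd_red s /\ phi s * z = phi a.

Local Notation B := (integralOver phi).

(** A relation rather than a map: a fraction denotes an element only if its denominator is regular,
    and an element has many fractions. *)
Definition represents (f : frac A) z := frac_valid f /\ phi f.2 * z = phi f.1.

Lemma phi_nzdI s y z : nzd_red s -> phi s * y = phi s * z -> y = z.
Proof.
move=> /inv_phi[t st] E; rewrite -[y]mul1r -[z]mul1r -st.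
by rewrite [phi s * t]mulrC -!mulrA E.
Qed.

Lemma represents_inj f y z : represents f y -> represents f z -> y = z.
Proof. by move=> [vf Ey] [_ Ez]; apply: (phi_nzdI vf); rewrite Ey. Qed.

Lemma represents_num f : frac_valid f -> exists z, represents f z.
Proof.
move=> vf; have [t st] := inv_phi vf; exists (t * phi f.1); split=> //.
by rewrite mulrA st mul1r.
Qed.

Lemma represents_den z : exists f, represents f z.
Proof. by have [s [a [hs E]]] := frac_phi z; exists (a, s). Qed.

Lemma represents_eq f g y z : represents f y -> represents g z -> frac_eq f g <-> y = z.
Proof.
move=> [vf Ef] [vg Eg]; rewrite /frac_eq -ker_phi rmorphB !rmorphM -Ef -Eg.
have -> : phi f.2 * y * phi g.2 - phi g.2 * z * phi f.2 = phi (f.2 * g.2) * y - phi (f.2 * g.2) * z.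
  by rewrite rmorphM; ring.
split=> [/eqP|->]; last by rewrite subrr.
by rewrite subr_eq0 => /eqP /phi_nzdI; apply; exact: nzd_redM.
Qed.

Lemma represents_add f g y z : represents f y -> represents g z ->
  represents (frac_add f g) (y + z).
Proof.
move=> [vf Ef] [vg Eg]; split; first exact: nzd_redM.
by rewrite /frac_add /= rmorphD !rmorphM -Ef -Eg; ring.
Qed.

Lemma represents_mul f g y z : represents f y -> represents g z ->
  represents (frac_mul f g) (y * z).
Proof.
move=> [vf Ef] [vg Eg]; split; first exact: nzd_redM.
by rewrite /frac_mul /= !rmorphM -Ef -Eg; ring.
Qed.

Lemma represents_embed a : represents (a, 1) (phi a).
Proof. by split; [move=> x; rewrite mul1r | rewrite rmorph1 mul1r]. Qed.

Lemma represents_integral f z : represents f z -> frac_integral f <-> B z.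
Proof.
move=> [vf E].
(* The homogenised polynomial of [frac_integral] is the monic polynomial at [z] times a power of the
   denominator. *)
have key d (c : nat -> A) :
    phi (f.1 ^+ d + \sum_(i < d) c i * f.1 ^+ i * f.2 ^+ (d - i)) =
    phi (f.2 ^+ d) * (z ^+ d + \sum_(i < d) phi (c i) * z ^+ i).
  rewrite rmorphD rmorphXn -E exprMn rmorphXn mulrDr; congr (_ + _).
  rewrite rmorph_sum mulr_sumr; apply: eq_bigr => i _.
  rewrite !rmorphM !rmorphXn -E exprMn.
  have -> : phi f.2 ^+ d = phi f.2 ^+ (d - i) * phi f.2 ^+ i by rewrite -exprD subnK // ltnW.
  by ring.
split.
  move=> [c]; move/ker_phi; rewrite (key (size c) (fun i => c`_i)) => E0.
  have {E0} E0 : z ^+ size c + \sum_(i < size c) phi c`_i * z ^+ i = 0.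
    by apply: (phi_nzdI (nzd_redX (n := size c) vf)); rewrite mulr0.
  pose p := \poly_(i < size c) c`_i.
  have szp : (size p < size ('X^(size c) : {poly A}))%N.
    by rewrite size_polyXn ltnS size_poly.
  exists ('X^(size c) + p).
    by rewrite monicE lead_coefDl // lead_coefXn.
  rewrite rootE rmorphD /= map_polyXn hornerD hornerXn.
  rewrite (@horner_coef_wide _ (size c)) ?(leq_trans (size_poly _ _)) ?size_poly //.
  under eq_bigr => i _ do rewrite coef_map coef_poly ltn_ord.
  by rewrite E0.
move=> [p mon_p /eqP pz].
pose d := (size p).-1.
have szp : size p = d.+1 by rewrite prednK // lt0n size_poly_eq0 monic_neq0.
have pd : p`_d = 1 by move: mon_p; rewrite monicE lead_coefE => /eqP.
exists (mkseq (fun i => p`_i) d); rewrite size_mkseq; apply/ker_phi.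
under eq_bigr do rewrite nth_mkseq //.
rewrite (key d (fun i => p`_i)); move: pz.
rewrite (@horner_coef_wide _ d.+1) ?size_map_poly_id0 ?szp //; last first.
  by rewrite (monicP mon_p) rmorph1 oner_eq0.
rewrite big_ord_recr /= coef_map /= pd rmorph1 mul1r addrC => E0.
under eq_bigr do rewrite -coef_map.
by rewrite E0 mulr0.
Qed.

Definition predF (K : Q -> Prop) f := exists2 z, represents f z & K z.
Definition predQ (K : frac A -> Prop) z := exists2 f, represents f z & K f.

Lemma predQF K z : predQ (predF K) z <-> K z.
Proof.
split; first by move=> [f fz [y fy Ky]]; rewrite (represents_inj fz fy).
by move=> Kz; have [f fz] := represents_den z; exists f => //; exists z.
Qed.

Lemma predFQ K f : cl_ideal K -> predF (predQ K) f <-> K f.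
Proof.
move=> [Kcl Keq _ _ _]; split.
  move=> [z fz [g gz Kg]]; apply: (Keq g) => //; last by apply/(represents_eq gz fz).
  split; first by case: fz.
  apply/(represents_integral fz)/(represents_integral gz).
  by case: (Kcl g Kg).
move=> Kf; have [vf _] := Kcl f Kf; have [z fz] := represents_num vf.
by exists z => //; exists f.
Qed.

Lemma cl_ideal_predQ K : cl_ideal K -> cl_idealQ phi (predQ K).
Proof.
move=> [Kcl Keq K0 KD KM]; split.
- by move=> z [f fz Kf]; apply/(represents_integral fz); case: (Kcl f Kf).
- by exists (frac0 A) => //; rewrite -(rmorph0 phi); exact: represents_embed.
- move=> y z [f fy Kf] [g gz Kg]; exists (frac_add f g); last exact: KD.
  exact: represents_add.
- move=> r z Br [f fz Kf]; have [g gr] := represents_den r.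
  exists (frac_mul g f); first exact: represents_mul.
  apply: KM => //; split; first by case: gr.
  exact/(represents_integral gr).
Qed.

Lemma cl_ideal_predF K : cl_idealQ phi K -> cl_ideal (predF K).
Proof.
move=> [KB K0 KD KM]; split.
- move=> f [z fz Kz]; split; first by case: fz.
  exact/(represents_integral fz)/KB.
- move=> f g [z fz Kz] [vg _] fg; exists z => //.
  by have [y gy] := represents_num vg; move/(represents_eq fz gy): fg => ->.
- by exists 0 => //; rewrite -(rmorph0 phi); exact: represents_embed.
- move=> f g [y fy Ky] [z gz Kz]; exists (y + z); last exact: KD.
  exact: represents_add.
- move=> r f [vr ir] [z fz Kz]; have [y ry] := represents_num vr.
  exists (y * z); first exact: represents_mul.
  by apply: KM => //; apply/(represents_integral ry).
Qed.

Lemma predQ1 K : cl_ideal K -> predQ K 1 <-> exists2 f, K f & frac_eq f (frac1 A).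
Proof.
have r1 : represents (frac1 A) 1 by rewrite -(rmorph1 phi); exact: represents_embed.
move=> HK; split.
  by move=> [f f1 Kf]; exists f => //; apply/(represents_eq f1 r1).
move=> [f Kf f1]; have [Kcl _ _ _ _] := HK; have [vf _] := Kcl f Kf.
have [z fz] := represents_num vf; exists f => //.
by move/(represents_eq fz r1): f1 => <-.
Qed.

Lemma cl_proper_predQ K : cl_proper K <-> cl_ideal K /\ ~ predQ K 1.
Proof.
split=> [[HK nK]|[HK nK]]; split=> //.
  by move=> /(predQ1 HK)[f /nK].
by move=> f Kf f1; apply: nK; apply/(predQ1 HK); exists f.
Qed.

Lemma cl_maximal_predQ K : cl_maximal K -> cl_maxQ phi (predQ K).
Proof.
move=> [/cl_proper_predQ[HK nK1] maxK]; split=> //; first exact: cl_ideal_predQ.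
move=> K' HK' nK'1 sub z K'z; have [f fz] := represents_den z; exists f => //.
apply: (maxK (predF K')); last by exists z.
  apply/cl_proper_predQ; split; first exact: cl_ideal_predF.
  by move/predQF.
by move=> g /(predFQ _ HK)[y gy /sub]; exists y.
Qed.

Lemma cl_maximal_predF K : cl_maxQ phi K -> cl_maximal (predF K).
Proof.
move=> [HK nK1 maxK]; split.
  apply/cl_proper_predQ; split; first exact: cl_ideal_predF.
  by move/predQF.
move=> K' /cl_proper_predQ[HK' nK'1] sub f /(predFQ _ HK')[z fz K'z].
exists z => //; apply: (maxK (predQ K')) => //; first exact: cl_ideal_predQ.
by move=> y /predQF[g gy /sub]; exists g.
Qed.

End Translation.

(** * The logarithmic formula and the conclusion *)

(** Taking logarithms puts [logb q X] above [n] and at most at [n.+1]; the shift by -1 moves this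
    interval to the one with ceiling [n]. *)
Lemma ceil_logb (q n X : nat) : (1 < q)%N -> (q ^ n < X)%N -> (X <= q ^ n.+1)%N ->
  Num.ceil (-1 + logb q%:R X%:R : Rdefinitions.R) = n%:Z.
Proof.
move=> q1 loX hiX.
have q0 : (0 < q)%N by exact: ltnW.
have lnX k : Rpower.ln (q ^ k)%N%:R = k%:R * Rpower.ln q%:R.
  rewrite natrX -RpowE -[in RHS]INRE; apply: Rpower.ln_pow.
  by apply/RltP; rewrite ltr0n.
have lnq : 0 < Rpower.ln q%:R.
  have -> : 0 = Rpower.ln 1 by rewrite Rpower.ln_1.
  apply/RltP/Rpower.ln_increasing; apply/RltP; first exact: ltr01.
  by rewrite ltr1n.
have lo : n%:R * Rpower.ln q%:R < Rpower.ln X%:R.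
  rewrite -lnX; apply/RltP/Rpower.ln_increasing; apply/RltP; last by rewrite ltr_nat.
  by rewrite ltr0n expn_gt0 q0.
have hi : Rpower.ln X%:R <= n.+1%:R * Rpower.ln q%:R.
  rewrite -lnX; move: hiX; rewrite leq_eqVlt => /orP[/eqP -> //|hiX].
  apply/ltW/RltP/Rpower.ln_increasing; apply/RltP; last by rewrite ltr_nat.
  by rewrite ltr0n; exact: leq_ltn_trans loX.
apply: ceil_def; rewrite /logb; apply/andP; split.
  by rewrite rmorphB /= addrC ltrD2l ltr_pdivlMr.
by rewrite addrC lerBlDr ler_pdivrMr //= -pmulrn natr1.
Qed.

Lemma geom_pred (q n : nat) : (0 < q)%N -> ((q - 1) * geom q n + 1 = q ^ n)%N.
Proof.
move=> q0; elim: n => [|n IH]; first by rewrite /geom big_ord0 muln0.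
rewrite geomS expnS -IH; nia.
Qed.

(** The bound yields an injective family of maximal length, and an element that it missed could be
    added to it. *)
Lemma finite_enumeration (T : Type) (P : T -> Prop) (L : nat) :
  (forall (M : nat) (f : 'I_M -> T), (forall i, P (f i)) -> injective f -> (M < L)%N) ->
  exists (N : nat) (f : 'I_N -> T),
    [/\ forall i, P (f i), injective f & forall x, P x -> exists i, x = f i].
Proof.
move=> HL.
pose fam M := `[< exists f : 'I_M -> T, (forall i, P (f i)) /\ injective f >].
have fam0 : exists M, fam M.
  have f0 : 'I_0 -> T by case.
  by exists 0%N; apply/asboolP; exists f0; split; case.
have famL M : fam M -> (M <= L)%N by move=> /asboolP[f [Pf /(HL M f Pf) /ltnW]].
case: (ex_maxnP fam0 famL) => N /asboolP[f [Pf fi]] maxN.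
exists N, f; split=> // x Px; apply: contrapT => nx.
suff /maxN : fam N.+1 by rewrite ltnn.
apply/asboolP; exists (fun i => if unlift ord0 i is Some j then f j else x); split.
  by move=> i; case: unliftP.
move=> i j; case: unliftP => [i'|] ->; case: unliftP => [j'|] -> //.
- by move/fi ->.
- by move=> E; case: nx; exists i'.
- by move=> E; case: nx; exists j'.
Qed.

Theorem theoremA (A : comNzRingType) (m : A -> Prop) (q : nat) :
  noetherian A -> local_with_max m -> krull_dim_one A -> residue_card m q ->
  exists N : nat, card_max_cl A N /\
  exists n : nat,
    [/\ (0 < n)%N,
        (forall I : A -> Prop, is_ideal I -> has_n_gen_reduction I n),
        (forall n', (0 < n')%N -> (forall I : A -> Prop, is_ideal I -> has_n_gen_reduction I n') ->
           (n <= n')%N) &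
        (n%:Z = Num.ceil (-1 + logb q%:R (q%:R + (q%:R - 1) * N%:R)
                  : Rdefinitions.R))].
Proof.
move=> noethA localA dimA [s [ss s_inj s_cov]].
pose sg (i : 'I_q) := s`_i.
have sg_inj i j : m (sg i - sg j) -> i = j by move=> /s_inj E; apply/val_inj/E.
have sg_cov x : exists i, m (x - sg i) by have [i iq Hi] := s_cov x; exists (Ordinal iq).
have q1 := residue_card_gt1 localA sg_cov.
pose Q := TotalQuotient.type A.
pose phi : {rmorphism A -> Q} := @TotalQuotient.embed A.
have ker_phi : forall a, phi a = 0 <-> nilp a := @TotalQuotient.embed_eq0 A.
have inv_phi : forall s, nzd_red s -> exists t, phi s * t = 1 := @TotalQuotient.embed_inv A.
have frac_phi : forall z, exists s a, nzd_red s /\ phi s * z = phi a := @TotalQuotient.embed_frac A.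
have [L HL] := cl_max_bound noethA localA ker_phi inv_phi frac_phi dimA sg_inj sg_cov.
have [|N [Ks [HK Kinj Kcov]]] := @finite_enumeration (Q -> Prop) (cl_maxQ phi) L.
  move=> M f Hf fi; apply: (HL M f Hf) => i j E; apply: fi.
  by apply/funext => z; apply/propext.
have dist i j : (forall z, Ks i z <-> Ks j z) -> i = j.
  by move=> E; apply: Kinj; apply/funext => z; apply/propext.
(* The zero ideal is proper, so a maximal ideal exists; this is what makes [n] positive. *)
have N0 : (0 < N)%N.
  have [|K /Kcov[i _] _] := cl_max_exists (cl_ideal0 phi); first exact/eqP/oner_neq0.
  exact: leq_ltn_trans (ltn_ord i).
exists N; split.
  (* The family is indexed by all natural numbers; from [N] on its predicates are empty. *)
  exists (fun i f => exists2 h : (i < N)%N, true & predF phi (Ks (Ordinal h)) f).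
  have MsE i (h : (i < N)%N) f : (exists2 h : (i < N)%N, true & predF phi (Ks (Ordinal h)) f)
      <-> predF phi (Ks (Ordinal h)) f.
    by split=> [[h' _]|]; [rewrite (bool_irrelevance h h') | exists h].
  split.
  - move=> i iN; have -> : (fun f => exists2 h : (i < N)%N, true & predF phi (Ks (Ordinal h)) f)
       = predF phi (Ks (Ordinal iN)) by apply/funext => f; apply/propext/MsE.
    exact: cl_maximal_predF.
  - move=> i j iN jN E; suff /(congr1 val) : Ordinal iN = Ordinal jN by [].
    apply: dist => z; rewrite -(predQF inv_phi frac_phi (Ks (Ordinal iN))).
    rewrite -(predQF inv_phi frac_phi (Ks (Ordinal jN))).
    by split=> -[f fz Hf]; exists f => //; apply/(MsE _ _ f)/E/(MsE _ _ f).
  - move=> K HKm; have [i Ei] := Kcov _ (cl_maximal_predQ ker_phi inv_phi frac_phi HKm).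
    exists i => // f; rewrite -(predFQ ker_phi inv_phi); last by case: HKm => [[]].
    rewrite Ei (MsE _ (ltn_ord i)).
    by have -> : Ordinal (ltn_ord i) = i by apply: val_inj.
have exn : exists n, (N < geom q n.+1)%N.
  exists N; rewrite -[X in (X <= _)%N](card_ord N.+1) -sum1_card.
  by apply: leq_sum => i _; rewrite expn_gt0 (ltnW q1).
(* The [n] sought is the least one with [N < geom q n.+1]. *)
case: (ex_minnP exn) => n Nn minn_n.
have n0 : (0 < n)%N.
  by case: n Nn {minn_n} => //; rewrite geomS /geom big_ord0 muln0 addn0 ltnS leqNgt N0.
exists n; split=> //.
- move=> I; exact: (exists_small_reduction noethA localA ker_phi inv_phi dimA
    sg_inj sg_cov HK Kcov Nn).
- move=> n' _ Hn'; rewrite leqNgt; apply/negP => n'n.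
  have [|I /Hn'] := exists_ideal_without_reduction (n := n') noethA localA inv_phi frac_phi
    sg_inj sg_cov HK dist; last by [].
  by rewrite leqNgt; apply/negP => /minn_n; rewrite leqNgt n'n.
have q0 := ltnW q1.
have XE : q%:R + (q%:R - 1) * N%:R = (q + (q - 1) * N)%N%:R :> Rdefinitions.R.
  by rewrite natrD natrM natrB.
rewrite XE (@ceil_logb _ n) //.
(* As [(q - 1) * geom q n + 1 = q ^ n], the bounds [geom q n <= N < geom q n.+1] say that
   [q + (q - 1) * N] exceeds [q ^ n] and is at most [q ^ n.+1]. *)
- have : (geom q n <= N)%N.
    by rewrite leqNgt; apply/negP; case: n n0 minn_n {Nn} => // n _ H /H; rewrite ltnn.
  have := geom_pred n q0; nia.
- have := geom_pred n.+1 q0; move: Nn; rewrite geomS; nia.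
Qed.
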